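(* Let $(Z_i)_{i\ge1}$ be a Markov chain on a finite set $\Sigma$, with transition probabilities $p(z,z')$, initial distribution $\pi_0$ (the law of $Z_1$), and stationary probability measure $\pi$. Then one can find a coupling $\mathbb{Q}$ between $(Z_i)$ and an i.i.d. collection $(W_i)_{i\ge1}$ with law $\pi$, in such a way that for any $\lambda>0$ and any integer $t\ge0$, $$\mathbb{Q}\big[\{Z_1,\dots,Z_t\}\subset\{W_1,\dots,W_R\}\big]\ \ge\ \mathbb{Q}\Big[\xi_0\pi_0(z)+\sum_{j=1}^{t-1}\xi_j\,p(Z_j,z)\le\lambda\pi(z)\ \text{ for all } z\in\Sigma\Big],$$ where $(\xi_i)_{i\ge0}$ are i.i.d. $\mathrm{Exp}(1)$ random variables, independent of $(Z_i)$ and of $R$, and $R=R_\lambda$ is a $\mathrm{Poisson}(\lambda)$-distributed random variable, independent of $(W_i)$.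
   Context: $\mathrm{Exp}(1)$ is the exponential distribution with mean $1$. A coupling is a probability space on which all the named random variables (including the $\xi_i$ and $R_\lambda$) are defined with the stated laws. *)

(* Defs.v *)
From HB Require Import structures.
From mathcomp Require Import all_boot all_order all_algebra finmap.
From mathcomp Require Import all_classical all_reals all_analysis.

Set Implicit Arguments.
Unset Strict Implicit.
Unset Printing Implicit Defensive.

Import Order.TTheory GRing.Theory Num.Theory.
Import numFieldNormedType.Exports.

Local Open Scope classical_set_scope.
Local Open Scope ring_scope.

Section finite_chains.
Context (R : realType) (S : finType).

Definition prob_vector (mu : S -> R) : Prop :=
  (forall z, 0 <= mu z) /\ \sum_z mu z = 1.

Definition stochastic (p : S -> S -> R) : Prop := forall z, prob_vector (p z).

Definition stationary (p : S -> S -> R) (mu : S -> R) : Prop :=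
  prob_vector mu /\ forall z', \sum_z mu z * p z z' = mu z'.

End finite_chains.

Section probability_notions.
Local Open Scope ereal_scope.
Context d (Omega : measurableType d) (R : realType) (Q : probability Omega R).

(* An abstract [S : finType] carries no [measurableType] structure (those are
   pointed), so variables with values in [S] are plain functions, measurable for
   the discrete sigma-algebra on [S], rather than terms of [{RV Q >-> _}]. *)
Definition sigma_discrete (S : finType) (X : Omega -> S) : set (set Omega) :=
  preimage_set_system setT X discrete_measurable.

Definition discrete_RV (S : finType) (X : Omega -> S) : Prop :=
  sigma_discrete X `<=` measurable.

Definition sigma_RV d' (T : measurableType d') (X : {RV Q >-> T}) :
    set (set Omega) :=
  preimage_set_system setT X measurable.

Definition has_law d' (T : measurableType d') (X : {RV Q >-> T})
    (mu : set T -> \bar R) : Prop :=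
  forall A, measurable A -> distribution Q X A = mu A.

Definition has_finite_law (S : finType) (X : Omega -> S) (mu : S -> R) : Prop :=
  discrete_RV X /\ forall z : S, Q [set w | X w = z] = (mu z)%:E.

(* Families (X_i)_(i >= 1) are encoded with a shift: [X i] stands for X_(i+1).
   The conditional probabilities of the Markov property are multiplied out, so
   that conditioning events of probability zero need no special case. *)
Definition markov_chain (S : finType) (pi0 : S -> R) (p : S -> S -> R)
    (Z : nat -> Omega -> S) : Prop :=
  [/\ forall i, discrete_RV (Z i),
      has_finite_law (Z 0%N) pi0 &
      forall (n : nat) (s : nat -> S),
        Q [set w | forall i, (i <= n.+1)%N -> Z i w = s i] =
        Q [set w | forall i, (i <= n)%N -> Z i w = s i]
          * (p (s n) (s n.+1))%:E].

Definition independent2 (F G : set (set Omega)) : Prop :=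
  forall A B, F A -> G B -> Q (A `&` B) = Q A * Q B.

Definition mutually_independent (F : nat -> set (set Omega)) : Prop :=
  forall (J : {fset nat}) (A : nat -> set Omega),
    (forall i, i \in J -> F i (A i)) ->
    Q (\bigcap_(i in [set` J]) A i) = \prod_(i <- J) Q (A i).

End probability_notions.

Definition sigma_join (T : Type) (F : nat -> set (set T)) : set (set T) :=
  <<s \bigcup_i F i >>.

(* Main.v *)
Require Import Defs.
From HB Require Import structures.
From mathcomp Require Import all_boot all_order all_algebra finmap.
From mathcomp Require Import all_classical all_reals all_analysis.

From mathcomp Require Import measurable_realfun ring lra zify.

Set Implicit Arguments.
Unset Strict Implicit.
Unset Printing Implicit Defensive.

Import Order.TTheory GRing.Theory Num.Theory.
Import numFieldNormedType.Exports.

Local Open Scope classical_set_scope.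
Local Open Scope ring_scope.

(** The proof follows the method of soft local times. Give each state [z] a clock
    set to an independent time [E_z] of law Exp(1), and let the clock of [z] run
    at speed [g z], where the speeds add up to 1. By lack of memory the first
    clock rings after a time of law Exp(1), it belongs to [z] with probability
    [g z], and what is left on the other clocks is again a family of independent
    exponentials, all of this independently ([step_law]). After setting the
    clock that rang to a new exponential time one can therefore go on with new
    speeds, which may depend on the past. With the speeds [p z] after [z] has
    rung, the states that ring form the Markov chain, and the waiting times are
    independent exponentials that are independent of the chain ([path_law]).
    With constant speeds [pist] the states that ring are independent with law
    [pist], and the rings occur at the times of a Poisson process independent of
    them, so that the number of rings up to time [lam] has the Poisson law
    ([arrival_count_law], [count_independent]).

    The coupling runs both explorations from the same initial clocks [E_z], with
    separate supplies of new times. In the first exploration a state visited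
    among the first [t] ones has [E_z] at most the distance run by its clock,
    which is [\sum_j xi_j p(Z_j, z)] if [xi_j] denotes the waiting times
    ([visited_le]); in the second one [z] rings before time [lam] as soon as
    [E_z <= lam * pist z] ([reached]). So the inclusion of the theorem holds
    whenever that sum is at most [lam * pist z] for all [z]. Only the first
    value on each clock matters, which is why nothing else has to be shared.

    The waiting times of the chain are not independent of the number of marks,
    because both depend on the initial clocks. The variables xi are instead a
    fresh sequence of exponentials, which together with the chain has the same
    law as the waiting times ([same_law]); the inequality only speaks of that
    law.

    Two computations replace integrals by estimates of increments
    ([eq_quadratic_increments]): the race of one exponential clock against the
    others ([exponential_race]) and the tail of a sum of exponentials
    ([arrival_tail]). Infinite sequences of independent variables come from a
    single uniform one, whose binary digits of even and odd index form two
    independent uniform variables ([subunif_split]). *)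

(** * Real-valued probabilities and the product rule *)

Section real_probability.
Context d (T : measurableType d) (R : realType) (Q : probability T R).
Implicit Types A B : set T.

(** Probabilities are computed with in [R], where [lra] and [ring] apply; [PrE]
    goes back to the extended reals. *)
Definition Pr A : R := fine (Q A).

Lemma PrE A : measurable A -> Q A = (Pr A)%:E.
Proof. by move=> mA; rewrite fineK// fin_num_measure. Qed.

Lemma Pr_setT : Pr setT = 1.
Proof. by rewrite /Pr probability_setT. Qed.

Lemma Pr_set0 : Pr set0 = 0.
Proof. by rewrite /Pr measure0. Qed.

Lemma Pr_ge0 A : 0 <= Pr A.
Proof. by rewrite /Pr fine_ge0. Qed.

Lemma le_Pr A B : measurable A -> measurable B -> A `<=` B -> Pr A <= Pr B.
Proof.
by move=> mA mB AB; rewrite -lee_fin -!PrE// le_measure// inE.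
Qed.

Lemma Pr_le1 A : measurable A -> Pr A <= 1.
Proof. by move=> mA; rewrite -Pr_setT le_Pr. Qed.

Lemma PrU A B : measurable A -> measurable B -> A `&` B = set0 ->
  Pr (A `|` B) = Pr A + Pr B.
Proof.
move=> mA mB AB; apply: EFin_inj; rewrite EFinD -!PrE//.
  by rewrite measureU.
exact: measurableU.
Qed.

Lemma PrDI A B : measurable A -> measurable B ->
  Pr A = Pr (A `&` B) + Pr (A `\` B).
Proof.
move=> mA mB; rewrite -PrU.
- by rewrite setUIDK.
- exact: measurableI.
- exact: measurableD.
- by rewrite setDE setIACA setICr setI0.
Qed.

Lemma Pr_setC A : measurable A -> Pr (~` A) = 1 - Pr A.
Proof.
move=> mA; rewrite -Pr_setT (PrDI measurableT mA) setTI setTD.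
by rewrite addrAC subrr add0r.
Qed.

(** Almost sure events can be intersected freely: this is how null sets (ties
    between clocks, degenerate digits) disappear from the computations. *)
Lemma PrI_full A B : measurable A -> measurable B -> Pr B = 1 ->
  Pr (A `&` B) = Pr A.
Proof.
move=> mA mB B1; rewrite (PrDI mA mB).
suff -> : Pr (A `\` B) = 0 by rewrite addr0.
apply/eqP; rewrite eq_le Pr_ge0 andbT.
apply: (@le_trans _ _ (Pr (~` B))).
  by apply: le_Pr; [exact: measurableD|exact: measurableC|move=> w []].
by rewrite Pr_setC// B1 subrr.
Qed.

(** Splits an event along the values of a variable with finitely many values;
    independent laws and Markov paths are both summed with it. *)
Lemma Pr_fiber (S : finType) (X : T -> S) (H : set T) (A : set S) :
  measurable H -> (forall z, measurable [set w | X w = z]) ->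
  Pr (H `&` [set w | A (X w)]) =
  \sum_(z | z \in A) Pr (H `&` [set w | X w = z]).
Proof.
move=> mH mX.
suff K (s : seq S) : uniq s ->
  measurable [set w | A (X w) /\ X w \in s] /\
  Pr (H `&` [set w | A (X w) /\ X w \in s]) =
  \sum_(z <- s | z \in A) Pr (H `&` [set w | X w = z]).
  have [_ <-] := K _ (index_enum_uniq S); congr (Pr (H `&` _)).
  by apply/seteqP; split => w /=; [move=> Aw|move=> [Aw _]]; rewrite ?mem_index_enum.
elim: s => [_|z s IH /= /andP[zs us]].
  rewrite big_nil (_ : [set w | _] = set0) ?setI0 ?Pr_set0//.
  by rewrite -subset0 => w /= [].
have {IH us} [mI IH] := IH us.
rewrite big_cons -IH.
have [zA|zA] := boolP (z \in A).
  have -> : [set w | A (X w) /\ X w \in z :: s] =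
     [set w | X w = z] `|` [set w | A (X w) /\ X w \in s].
    apply/seteqP; split => w /=; rewrite in_cons.
      by move=> [Aw /orP[/eqP|]]; tauto.
    move=> [->|[? ->]]; rewrite ?eqxx ?orbT//; split => //.
    by move: zA; rewrite inE.
  split; first exact: measurableU.
  rewrite setIUr PrU//; try exact: measurableI.
  rewrite -subset0 => w /= [[_ wz] [_ [_]]].
  by rewrite wz (negbTE zs).
have -> : [set w | A (X w) /\ X w \in z :: s] =
     [set w | A (X w) /\ X w \in s]; last by [].
apply/seteqP; split => w /=; rewrite in_cons.
  move=> [Aw /orP[/eqP Xz|]]; last by [].
  by move: zA; rewrite -Xz notin_setE.
by move=> [? ->]; rewrite orbT.
Qed.

End real_probability.

Lemma preimage_sigma d (T : measurableType d) (V : Type) (X : T -> V)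
    (G : set (set V)) :
  (forall A, G A -> measurable (X @^-1` A)) ->
  forall A, <<s G >> A -> measurable (X @^-1` A).
Proof.
move=> mG; apply: smallest_sub => //; split => /=.
- by rewrite preimage_set0.
- by move=> A mA; rewrite setTD -preimage_setC; exact: measurableC.
- by move=> F mF; rewrite preimage_bigcup; exact: bigcup_measurable.
Qed.

(** The one application of Dynkin's lemma on which everything rests. With [H]
    the whole space it says that two laws agree; with [Y = X] that [X] is
    independent of [H]; in general, that the law of [X] conditioned on [H] is
    the law of [Y], whatever the space on which [Y] lives. *)
Lemma product_rule_sigma (R : realType) d1 (T1 : measurableType d1)
    (Q1 : probability T1 R) d2 (T2 : measurableType d2) (Q2 : probability T2 R)
    (V : pointedType) (X : T1 -> V) (Y : T2 -> V) (G : set (set V)) (H : set T1) :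
  setI_closed G -> (forall A, G A -> measurable (X @^-1` A)) ->
  (forall A, G A -> measurable (Y @^-1` A)) -> measurable H ->
  (forall A, G A -> Pr Q1 (H `&` X @^-1` A) = Pr Q1 H * Pr Q2 (Y @^-1` A)) ->
  forall A, <<s G >> A -> Pr Q1 (H `&` X @^-1` A) = Pr Q1 H * Pr Q2 (Y @^-1` A).
Proof.
move=> GI mX mY mH GP.
have msX := preimage_sigma mX; have msY := preimage_sigma mY.
apply: (@dynkin_induction _ (g_sigma_algebraType G)) => //.
- by rewrite !preimage_setT setIT Pr_setT mulr1.
- move=> A mA IH.
  have HC : Pr Q1 (H `&` X @^-1` ~` A) = Pr Q1 H - Pr Q1 (H `&` X @^-1` A).
    by rewrite preimage_setC -setDE (PrDI Q1 mH (msX _ mA)) addrAC subrr add0r.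
  have YC : Pr Q2 (Y @^-1` ~` A) = 1 - Pr Q2 (Y @^-1` A).
    by rewrite preimage_setC Pr_setC//; exact: (msY _ mA).
  by rewrite HC YC IH mulrBr mulr1.
- move=> F mF tF IH.
  have sU : <<s G >> (\bigcup_k F k).
    exact: (@bigcupT_measurable _ (g_sigma_algebraType G)).
  apply: EFin_inj; rewrite EFinM -!PrE//; last 2 first.
    exact: msY.
    by apply: measurableI => //; exact: msX.
  rewrite !preimage_bigcup setI_bigcupr.
  have tX : trivIset setT (fun k => H `&` X @^-1` F k).
    apply/trivIsetP => i j _ _ ij; rewrite setIACA -preimage_setI.
    by move/trivIsetP : tF => ->//; rewrite preimage_set0 setI0.
  have tY : trivIset setT (fun k => Y @^-1` F k).
    apply/trivIsetP => i j _ _ ij; rewrite -preimage_setI.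
    by move/trivIsetP : tF => ->//; rewrite preimage_set0.
  rewrite !measure_semi_bigcup//=.
  + rewrite [in RHS]PrE// -nneseriesZl//; apply: eq_eseriesr => k _.
    rewrite !PrE; [by rewrite -EFinM IH|exact: (msY _ (mF k))|].
    by apply: measurableI => //; exact: (msX _ (mF k)).
  + by move=> k; exact: (msY _ (mF k)).
  + by apply: bigcup_measurable => k _; exact: (msY _ (mF k)).
  + by move=> k; apply: measurableI => //; exact: (msX _ (mF k)).
  + apply: bigcup_measurable => k _.
    by apply: measurableI => //; exact: (msX _ (mF k)).
Qed.

(** * Measurability, and the product rule for real variables *)

Lemma measurable_preimageT d d' (T : measurableType d) (U : measurableType d')
  (f : T -> U) (A : set U) :
  measurable_fun setT f -> measurable A -> measurable (f @^-1` A).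
Proof. by move=> mf mA; rewrite -[X in measurable X]setTI; exact: mf. Qed.

Lemma measurable_le_set d (T : measurableType d) (R : realType) (f g : T -> R) :
  measurable_fun setT f -> measurable_fun setT g ->
  measurable [set w | f w <= g w].
Proof.
move=> mf mg; have := measurable_fun_ler mf mg.
by move=> /(_ measurableT [set true] I); rewrite setTI.
Qed.

Lemma measurable_lt_set d (T : measurableType d) (R : realType) (f g : T -> R) :
  measurable_fun setT f -> measurable_fun setT g ->
  measurable [set w | f w < g w].
Proof.
move=> mf mg; have := measurable_fun_ltr mf mg.
by move=> /(_ measurableT [set true] I); rewrite setTI.
Qed.

Lemma measurable_forall_lt d (T : measurableType d) (A : nat -> set T) n :
  (forall i, (i < n)%N -> measurable (A i)) ->
  measurable [set w | forall i, (i < n)%N -> A i w].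
Proof.
move=> mA; rewrite [X in measurable X](_ : _ = \bigcap_(i in `I_n) A i)//.
by apply: bigcap_measurableType => i; exact: mA.
Qed.

Lemma measurable_forall_fin d (T : measurableType d) (S : finType)
    (A : S -> set T) :
  (forall i, measurable (A i)) -> measurable [set w | forall i, A i w].
Proof.
move=> mA; rewrite [X in measurable X](_ : _ =
    \bigcap_(n : nat) (oapp A setT (@choice.unpickle _ n))).
  by apply: bigcapT_measurable => n; case: (@choice.unpickle _ n) => [i|]/=.
apply/seteqP; split => w /= Aw => [n _|i]; first by case: (@choice.unpickle _ n) => [i|]/=.
by have := Aw (choice.pickle i) I; rewrite choice.pickleK.
Qed.

Lemma measurable_exists_count d (T : measurableType d) (K : countType)
    (A : K -> set T) :
  (forall i, measurable (A i)) -> measurable [set w | exists i, A i w].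
Proof.
move=> mA; rewrite [X in measurable X](_ : _ =
    \bigcup_(n : nat) (oapp A set0 (@choice.unpickle _ n))).
  by apply: bigcupT_measurable => n; case: (@choice.unpickle _ n) => [i|]/=.
apply/seteqP; split => w /=.
  by move=> [i Aw]; exists (choice.pickle i) => //=; rewrite choice.pickleK.
by move=> [n _]; case: (@choice.unpickle _ n) => // i; exists i.
Qed.

(** A function defined by cases on a discrete variable is measurable when each
    case is. The exploration below is such a function, since which clock rings,
    and hence how the clocks move, depends on a discrete outcome. *)
Lemma measurable_countable_case d (T : measurableType d)
    d' (U : measurableType d') (K : countType) (D : T -> K) (f : K -> T -> U) :
  (forall k, measurable [set w | D w = k]) ->
  (forall k, measurable_fun setT (f k)) ->
  measurable_fun setT (fun w => f (D w) w).
Proof.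
move=> mD mf _ B mB; rewrite setTI.
rewrite [X in measurable X](_ : _ =
    [set w | exists k, ([set w | D w = k] `&` f k @^-1` B) w]).
  apply: measurable_exists_count => k; apply: measurableI => //.
  exact: measurable_preimageT.
by apply/seteqP; split => w /= => [Bw|[k [<-]]]; [exists (D w)|].
Qed.

Lemma measurable_nat_fun d (T : measurableType d) (f : T -> nat) :
  (forall n, measurable [set w | (n < f w)%N]) -> measurable_fun setT f.
Proof.
move=> mf; have mge n : measurable [set w | (n <= f w)%N].
  case: n => [|n]; last exact: mf.
  by rewrite [X in measurable X](_ : _ = setT)//; exact/seteqP.
rewrite (_ : f = fun w => id (f w))//.
apply: (@measurable_countable_case _ _ _ _ _ f (fun k _ => k)) => [k|k].
  rewrite [X in measurable X](_ : _ = [set w | (k <= f w)%N] `\`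
     [set w | (k < f w)%N]); first exact: measurableD.
  by apply/seteqP; split => w /= => [->|[]]; lia.
exact: measurable_cst.
Qed.

(** [product_rule_sigma] for real variables, tested on the rays on which
    distribution functions are read. *)
Lemma real_product_rule (R : realType) d1 (T1 : measurableType d1)
    (Q1 : probability T1 R) d2 (T2 : measurableType d2) (Q2 : probability T2 R)
    (X : T1 -> R) (Y : T2 -> R) (H : set T1) :
  measurable_fun setT X -> measurable_fun setT Y -> measurable H ->
  (forall x, Pr Q1 (H `&` [set w | X w <= x]) =
             Pr Q1 H * Pr Q2 [set w | Y w <= x]) ->
  forall A, measurable A ->
    Pr Q1 (H `&` X @^-1` A) = Pr Q1 H * Pr Q2 (Y @^-1` A).
Proof.
move=> mX mY mH XY A mA.
have mray (x : R) : measurable `]-oo, x]%classic by exact: measurable_itv.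
apply: (@product_rule_sigma R _ _ Q1 _ _ Q2 R X Y
    [set A | exists x, A = `]-oo, x]%classic]) => //.
- move=> _ _ [x ->] [y ->]; exists (Num.min x y).
  by apply/seteqP; split => t /=; rewrite !in_itv/= le_min => /andP.
- by move=> _ [x ->]; exact: measurable_preimageT.
- by move=> _ [x ->]; exact: measurable_preimageT.
- by move=> _ [x ->]; rewrite !preimage_itvNyc; exact: XY.
- have : (@ocitv R).-sigma.-measurable A by [].
  rewrite RGenOInfty.measurableE; apply: smallest_sub.
    exact: smallest_sigma_algebra.
  move=> _ [x ->]; rewrite -setCitvl.
  have [_ SC _] := smallest_sigma_algebra setT
    [set A | exists x : R, A = `]-oo, x]%classic].
  by rewrite -setTD; apply: SC; apply: sub_sigma_algebra; exists x.
Qed.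

(** * A sequence of independent exponential variables *)

Section uniform.
Variable R : realType.
Definition unif : probability (measurableTypeR R) R := uniform_prob (@ltr01 R).

Lemma measurable_id_unif : measurable_fun [set: measurableTypeR R] (fun u : measurableTypeR R => u : R).
Proof. exact: measurable_id. Qed.

Lemma unif_itv (a b : R) : 0 <= a -> a <= b -> b <= 1 ->
  Pr unif [set u : R | a <= u < b] = b - a.
Proof.
move=> a0 ab b1; rewrite /Pr/= /uniform_prob integral_uniform_pdf.
have abE : [set u : R | a <= u < b] `&` `[0, 1]%classic = `[a, b[%classic.
  apply/seteqP; split => u /=; rewrite !in_itv/=; last by lra.
  by move=> [].
rewrite abE (_ : (\int[_]_(x in _) _)%E =
    (\int[lebesgue_measure]_(x in `[a, b[) 1%:E)%E).
  rewrite integral_cst ?mul1e; last exact: measurable_itv.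
  rewrite /= lebesgue_measure_itv/= lte_fin.
  by case: ltP => // ba; rewrite /=; lra.
rewrite -abE; apply: eq_integral => x; rewrite inE => -[_]; rewrite /= in_itv/= => x01.
by rewrite /uniform_pdf x01 subr0 invr1.
Qed.

Lemma unif01 : Pr unif [set u : R | 0 <= u < 1] = 1.
Proof. by rewrite unif_itv// subr0. Qed.

End uniform.

Section digits.
Variable R : realType.
Implicit Types (u x y : R) (m k l o : nat).

(** The binary digit of weight [2 ^- i.+1]: [truncn (2 ^+ i.+1 * u)] has the
    first [i.+1] digits of [u] as its binary expansion. *)
Definition digit i u : bool := odd (Num.truncn (2 ^+ i.+1 * u)).

(** The integer formed by the first [m] digits of [u] whose index has parity
    [o], for [o] equal to 0 or 1. *)
Fixpoint subdigits o m u : nat :=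
  if m is m'.+1 then ((subdigits o m' u).*2 + digit (m'.*2 + o) u)%N else 0%N.

(** The integer whose binary digits alternate between those of [k] and those of
    [l]; it inverts the extraction of the digits of even and odd index. *)
Fixpoint interleave m k l : nat :=
  if m is m'.+1 then (4 * interleave m' k./2 l./2 + (odd k).*2 + odd l)%N
  else 0%N.

Lemma subdigits_lt o m u : (subdigits o m u < 2 ^ m)%N.
Proof. by elim: m => //= m IH; rewrite expnS; case: digit; lia. Qed.

Lemma interleave_lt m k l : (interleave m k l < 4 ^ m)%N.
Proof.
elim: m k l => //= m IH k l; have := IH k./2 l./2.
by rewrite expnS; case: (odd k); case: (odd l); lia.
Qed.

Lemma truncn_half y : 0 <= y -> (Num.truncn (2 * y))./2 = Num.truncn y.
Proof.
move=> y0; apply/esym/eqP; rewrite truncn_eq//.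
have y20 : 0 <= 2 * y by lra.
have := truncn_itv y20; set n := Num.truncn _ => /andP[n1 n2].
have e := odd_double_half n.
have en : n%:R = (odd n)%:R + 2 * (n./2)%:R :> R.
  by rewrite -[in LHS]e natrD -mul2n natrM.
move: n1 n2; rewrite -!natr1 en.
by case: (odd n) => /= n1 n2; apply/andP; split; lra.
Qed.

(** Prescribing the first [m] digits of each parity amounts to prescribing the
    first [2 m] digits, that is to putting [u] in one dyadic interval: this is
    why digits are independent and fair. *)
Lemma subdigitsP m k l u : 0 <= u < 1 -> (k < 2 ^ m)%N -> (l < 2 ^ m)%N ->
  (subdigits 0 m u = k /\ subdigits 1 m u = l) <->
  Num.truncn (2 ^+ m.*2 * u) = interleave m k l.
Proof.
move=> /andP[u0 u1]; elim: m k l => [|m IH] k l; rewrite ?expn0 ?expnS.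
  move=> k0 l0; rewrite expr0 mul1r/=.
  have -> : Num.truncn u = 0%N by apply: truncn_def; rewrite u0 u1.
  by split => // _; lia.
move=> k2 l2 /=; have := IH k./2 l./2.
have p0 i : 0 <= 2 ^+ i * u by rewrite mulr_ge0// exprn_ge0.
rewrite /digit addn0 addn1.
have -> : 2 ^+ m.*2.+2 * u = 2 * (2 ^+ m.*2.+1 * u) :> R.
  by rewrite mulrA -exprS.
have := truncn_half (p0 m.*2.+1).
have := truncn_half (p0 m.*2).
rewrite mulrA -exprS => h1 h2; rewrite -{}h1 -h2.
move: (Num.truncn _) (subdigits 0 m u) (subdigits 1 m u)
  (interleave m k./2 l./2) => c a b i.
have ec := odd_double_half c; have ec2 := odd_double_half c./2.
have ek := odd_double_half k; have el := odd_double_half l.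
move=> H.
have {}H : (a = k./2 /\ b = l./2) <-> (c./2)./2 = i by apply: H; lia.
split.
  move=> [ak bl].
  have [] : a = k./2 /\ b = l./2 by lia.
  by move=> a' b'; have := H.1 (conj a' b'); lia.
move=> ci.
have : (c./2)./2 = i by move: (odd k) (odd l) ci ec ec2 => [] [] /=; lia.
by move=> /H[]; move: ci ec ec2 ek el; case: (odd k); case: (odd l); lia.
Qed.

End digits.

Lemma measurable_nat_fiber d (T : measurableType d) (f : T -> nat) (P : pred nat) :
  measurable_fun setT f -> measurable [set w | P (f w)].
Proof.
move=> mf; rewrite [X in measurable X](_ : _ = f @^-1` [set n | P n])//.
exact: measurable_preimageT.
Qed.

Lemma measurable_nat_fiber1 d (T : measurableType d) (f : T -> nat) k :
  measurable_fun setT f -> measurable [set w | f w = k].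
Proof.
move=> mf; rewrite [X in measurable X](_ : _ = [set w | f w == k]).
  exact: (measurable_nat_fiber (pred1 k)).
by apply/seteqP; split => w /= /eqP.
Qed.

Lemma Pr_count (R : realType) d (T : measurableType d) (Q : probability T R)
    (f : T -> nat) (H : set T) (c : R) N :
  measurable H -> measurable_fun setT f ->
  (forall k, (k < N)%N -> Pr Q (H `&` [set w | f w = k]) = c) ->
  forall K, (K <= N)%N -> Pr Q (H `&` [set w | (f w < K)%N]) = K%:R * c.
Proof.
move=> mH mf Hc; elim=> [_|K IH KN].
  by rewrite (_ : _ `&` _ = set0) ?Pr_set0 ?mul0r// -subset0 => w /= [].
rewrite -natr1 mulrDl mul1r -IH; last exact: ltnW.
rewrite -(Hc K KN) -PrU.
- rewrite -setIUr; congr (Pr Q (_ `&` _)).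
  by apply/seteqP; split => w /=; lia.
- by apply: measurableI => //; exact: measurable_nat_fiber (fun n => n < K)%N _.
- by apply: measurableI => //; exact: measurable_nat_fiber1.
- by rewrite -subset0 => w /= [[_ ?] [_ ?]]; lia.
Qed.

Section split_uniform.
Variable R : realType.
Local Notation P := (unif R).
Implicit Types (x y : R) (m k l o : nat).
Local Notation T := (measurableTypeR R).

Lemma measurable_truncn_scale (a : R) :
  measurable_fun [set: T] (fun u : T => Num.truncn (a * (u : R))).
Proof.
apply: measurable_nat_fun => n.
rewrite [X in measurable X](_ : _ = [set u : T | n.+1%:R <= a * (u : R)]).
  apply: measurable_le_set; first exact: measurable_cst.
  by apply: measurable_funM; [exact: measurable_cst|exact: measurable_id_unif].
by apply/seteqP; split => u /=; rewrite truncn_gt_nat.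
Qed.

Lemma measurable_digit i : measurable_fun [set: T] (fun u : T => digit i (u : R)).
Proof.
apply: (@measurable_countable_case _ T _ bool _
  (fun u : T => Num.truncn (2 ^+ i.+1 * (u : R))) (fun k _ => odd k)) => [k|k].
  exact: (measurable_nat_fiber1 k (measurable_truncn_scale _)).
exact: measurable_cst.
Qed.

Lemma measurable_subdigits o m :
  measurable_fun [set: T] (fun u : T => subdigits o m (u : R)).
Proof.
elim: m => [|m IH]; first exact: measurable_cst.
pose D (u : T) : nat * bool := (subdigits o m (u : R), digit (m.*2 + o) (u : R)).
pose f (k : nat * bool) (_ : T) : nat := (k.1.*2 + k.2)%N.
apply: (@measurable_countable_case _ _ _ _ _ D f); last first.
  by move=> k; exact: measurable_cst.
move=> [k b].
rewrite [X in measurable X](_ : _ = [set u : T | subdigits o m (u : R) = k] `&`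
    (fun u : T => digit (m.*2 + o) (u : R)) @^-1` [set b]).
  apply: measurableI; first exact: (measurable_nat_fiber1 k IH).
  by apply: measurable_preimageT => //; exact: measurable_digit.
by apply/seteqP; split => u /= [<- <-].
Qed.

Lemma unif_subdigits m k l : (k < 2 ^ m)%N -> (l < 2 ^ m)%N ->
  Pr P ([set u : T | subdigits 0 m (u : R) = k] `&`
        [set u : T | subdigits 1 m (u : R) = l]) = (4 ^+ m)^-1.
Proof.
move=> km lm.
have m0 := measurable_nat_fiber1 k (measurable_subdigits 0 m).
have m1 := measurable_nat_fiber1 l (measurable_subdigits 1 m).
have mid := @measurable_id_unif R.
have m01 : measurable [set u : T | 0 <= (u : R) < 1].
  rewrite [X in measurable X](_ : _ = [set u : T | 0 <= (u : R)] `&`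
     [set u : T | (u : R) < 1]).
    apply: measurableI.
      by apply: measurable_le_set => //; exact: measurable_cst.
    by apply: measurable_lt_set => //; exact: measurable_cst.
  by apply/seteqP; split => u /= => [/andP[]|[-> ->]].
rewrite -(PrI_full (measurableI _ _ m0 m1) m01 (unif01 R)).
pose c := interleave m k l.
have p4 : 0 < 4 ^+ m :> R by rewrite exprn_gt0.
have E24 : 2 ^+ m.*2 = 4 ^+ m :> R by rewrite -mul2n exprM; congr (_ ^+ _); lra.
have c4 : c.+1%:R <= 4 ^+ m :> R by rewrite -natrX ler_nat interleave_lt.
rewrite [X in Pr _ X](_ : _ =
    [set u : R | c%:R / 4 ^+ m <= u < c.+1%:R / 4 ^+ m]).
  rewrite unif_itv.
  - by rewrite -mulrBl -natr1 addrC addKr mul1r.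
  - by rewrite divr_ge0// ltW.
  - by rewrite ler_pM2r ?invr_gt0// ler_nat.
  - by rewrite ler_pdivrMr// mul1r.
apply/seteqP; split => u /=.
  move=> [/[swap] u01 /(subdigitsP u01 km lm)]; rewrite -/c E24 => /eqP.
  case/andP: u01 => u0 u1; rewrite truncn_eq; last by rewrite mulr_ge0// ltW.
  by rewrite ler_pdivrMr// ltr_pdivlMr// mulrC.
rewrite ler_pdivrMr// ltr_pdivlMr// => cu.
have u01 : 0 <= u < 1.
  move: cu => /andP[cu1 cu2]; apply/andP; split.
    by rewrite -(pmulr_lge0 _ p4)//; apply: le_trans cu1.
  by rewrite -(ltr_pM2r p4) mul1r; exact: lt_le_trans c4.
split => //; apply/(subdigitsP u01 km lm)/eqP; rewrite -/c E24.
case/andP: u01 => u0 u1; rewrite truncn_eq; last by rewrite mulr_ge0// ltW.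
by rewrite mulrC.
Qed.

(** At level [m] the two integers are independent and uniform on the integers
    below [2 ^ m]. *)
Lemma unif_subdigits_box m K L : (K <= 2 ^ m)%N -> (L <= 2 ^ m)%N ->
  Pr P ([set u : T | (subdigits 0 m (u : R) < K)%N] `&`
        [set u : T | (subdigits 1 m (u : R) < L)%N]) =
  (K%:R / 2 ^+ m) * (L%:R / 2 ^+ m).
Proof.
move=> Km Lm; have mm o := measurable_subdigits o m.
have mK : measurable [set u : T | (subdigits 0 m (u : R) < K)%N].
  exact: measurable_nat_fiber (fun n => n < K)%N _.
rewrite (@Pr_count _ _ _ _ _ _ (K%:R * (4 ^+ m)^-1) (2 ^ m))//.
  by rewrite (_ : 4 = 2 * 2 :> R) ?exprMn ?invfM; [ring|lra].
move=> l lm; rewrite setIC.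
rewrite (@Pr_count _ _ _ _ _ _ ((4 ^+ m)^-1) (2 ^ m))//.
  exact: measurable_nat_fiber1.
by move=> k km; rewrite setIC; exact: unif_subdigits.
Qed.

End split_uniform.

Lemma measurable_fun_le_sets d (T : measurableType d) (R : realType)
    (f : T -> R) :
  (forall x, measurable [set w | f w <= x]) -> measurable_fun setT f.
Proof.
move=> mf; apply: (measurability _ (RGenOInfty.measurableE R)) => //.
move=> _ [_ [x ->] <-]; rewrite setTI [X in measurable X](_ : _ =
    ~` [set w | f w <= x]); first exact: measurableC.
by apply/seteqP; split => w /=; rewrite in_itv/= andbT ltNge => /negP.
Qed.

Section split_uniform.
Variable R : realType.
Local Notation P := (unif R).
Local Notation T := (measurableTypeR R).
Implicit Types (x y : R) (u : T) (m k l o : nat).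

(** The number whose binary digits are the digits of [u] of parity [o]. As a
    supremum it comes with the criterion [subunif_le], in which only finitely
    many digits enter at each level. *)
Definition subunif o (u : R) : R :=
  sup (range (fun m => (subdigits o m u)%:R / 2 ^+ m)).

Lemma subunif_le o (u : R) x :
  subunif o u <= x <-> forall m, (subdigits o m u)%:R <= 2 ^+ m * x.
Proof.
have p2 m : 0 < 2 ^+ m :> R by rewrite exprn_gt0.
have hs : has_ubound (range (fun m => (subdigits o m u)%:R / 2 ^+ m : R)).
  exists 1 => _ [m _ <-]; rewrite ler_pdivrMr// mul1r -natrX ler_nat.
  by rewrite ltnW// subdigits_lt.
split=> [ux m|H].
  rewrite mulrC -ler_pdivrMr//; apply: le_trans ux.
  by apply: ub_le_sup => //; exists m.
apply: ge_sup; first by exists ((subdigits o 0 u)%:R / 2 ^+ 0); exists 0%N.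
by move=> _ [m _ <-]; rewrite ler_pdivrMr// mulrC.
Qed.

Lemma subunif_ge0 o (u : R) : 0 <= subunif o u.
Proof.
have := lexx (subunif o u); rewrite subunif_le => /(_ 0%N).
by rewrite expr0 mul1r.
Qed.

Lemma subunif_le1 o (u : R) : subunif o u <= 1.
Proof.
by rewrite subunif_le => m; rewrite mulr1 -natrX ler_nat ltnW// subdigits_lt.
Qed.

Let K x m := minn (Num.truncn (2 ^+ m * x)).+1 (2 ^ m).

Let subdigits_K o (u : R) x m : 0 <= x ->
  ((subdigits o m u)%:R <= 2 ^+ m * x) = (subdigits o m u < K x m)%N.
Proof.
move=> x0; rewrite /K leq_min subdigits_lt andbT ltnS truncn_ge_nat//.
by rewrite mulr_ge0// exprn_ge0.
Qed.

Lemma measurable_subunif o : measurable_fun [set: T] (fun u => subunif o (u : R)).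
Proof.
apply: measurable_fun_le_sets => x.
rewrite [X in measurable X](_ : _ = \bigcap_m
  [set u | (subdigits o m (u : R))%:R <= 2 ^+ m * x]).
  apply: bigcapT_measurable => m; apply: measurable_le_set => //.
  apply: (@measurable_countable_case _ T _ _ nat (fun u => subdigits o m (u : R))
    (fun k _ => k%:R : R)) => k.
    exact: (measurable_nat_fiber1 k (@measurable_subdigits R o m)).
  exact: measurable_cst.
apply/seteqP; split => u /=.
  by move=> /subunif_le ux m _; exact: ux.
by move=> H; apply/subunif_le => m; exact: H.
Qed.

Let K_cvg x : 0 <= x <= 1 -> (K x m)%:R / 2 ^+ m @[m --> \oo] --> x.
Proof.
move=> /andP[x0 x1].
have p2 m : 0 < 2 ^+ m :> R by rewrite exprn_gt0.
have lim : x + 2^-1 ^+ m @[m --> \oo] --> x.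
  rewrite -[X in _ --> X]addr0; apply: cvgD; first exact: cvg_cst.
  by apply: cvg_expr; rewrite gtr0_norm ?invr_gt0// invf_lt1// ltr1n.
apply: squeeze_cvgr lim; last exact: cvg_cst.
apply: nearW => m.
have y0 : 0 <= 2 ^+ m * x by rewrite mulr_ge0// ltW.
have /andP[t1 t2] := truncn_itv y0.
rewrite ler_pdivlMr// ler_pdivrMr// mulrDl exprVn mulVf ?gt_eqF//.
rewrite ![x * _]mulrC /K; apply/andP; split.
  rewrite /minn; case: ifP => _; first exact: ltW.
  by rewrite natrX ger_pMr.
apply: (@le_trans _ _ (Num.truncn (2 ^+ m * x)).+1%:R).
  by rewrite ler_nat geq_minl.
by rewrite -natr1 lerD2r.
Qed.

Lemma measurable_subunif_le o x : measurable [set u : T | subunif o (u : R) <= x].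
Proof. by apply: measurable_le_set => //; exact: measurable_subunif. Qed.

(** The event is the decreasing limit of the dyadic boxes of
    [unif_subdigits_box], whose sides converge to [x] and [y]. *)
Lemma subunif_box x y : 0 <= x <= 1 -> 0 <= y <= 1 ->
  Pr P ([set u : T | subunif 0 (u : R) <= x] `&`
        [set u : T | subunif 1 (u : R) <= y]) = x * y.
Proof.
move=> x01 y01; have x0 : 0 <= x by case/andP: x01.
have y0 : 0 <= y by case/andP: y01.
pose A m := [set u : T | (subdigits 0 m (u : R) < K x m)%N] `&`
            [set u : T | (subdigits 1 m (u : R) < K y m)%N].
have mA m : measurable (A m).
  apply: measurableI.
    exact: (measurable_nat_fiber (fun n => n < _)%N (@measurable_subdigits R 0 m)).
  exact: (measurable_nat_fiber (fun n => n < _)%N (@measurable_subdigits R 1 m)).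
have EA : [set u : T | subunif 0 (u : R) <= x] `&`
          [set u : T | subunif 1 (u : R) <= y] = \bigcap_m A m.
  apply/seteqP; split => u /=.
    move=> [/subunif_le ux /subunif_le uy] m _.
    by split; rewrite /= -subdigits_K.
  move=> H; split; apply/subunif_le => m; rewrite subdigits_K//;
    by have [] := H m I.
have ndA : nonincreasing_seq A.
  apply/nonincreasing_seqP => m; apply/subsetPset => u [h0 h1].
  have step o (z : R) : 0 <= z -> (subdigits o m.+1 (u : R) < K z m.+1)%N ->
      (subdigits o m (u : R) < K z m)%N.
    move=> z0; rewrite -!subdigits_K// exprS -mulrA => h.
    rewrite -(@ler_pM2l _ 2)//; apply: le_trans h.
    by rewrite /= -natrM ler_nat; case: digit => /=; lia.
  by split; [exact: step h0|exact: step h1].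
have mI : measurable (\bigcap_m A m) by exact: bigcapT_measurable.
have cv : Pr P (A m) @[m --> \oo] --> Pr P (\bigcap_m A m).
  apply/fine_cvg; rewrite -PrE//.
  apply: (@nonincreasing_cvg_mu _ _ _ P A) => //.
  by rewrite [ltLHS](PrE _ (mA 0%N)) ltry.
have cv' : Pr P (A m) @[m --> \oo] --> x * y.
  rewrite (_ : (fun m => _) =
      (fun m => ((K x m)%:R / 2 ^+ m) * ((K y m)%:R / 2 ^+ m))).
    by apply: cvgM; exact: K_cvg.
  by apply/funext => m; rewrite /A unif_subdigits_box// geq_minr.
by rewrite EA; exact: (cvg_unique _ cv cv').
Qed.

End split_uniform.

Section iid.
Variable R : realType.
Local Notation P := (unif R).
Local Notation T := (measurableTypeR R).
Implicit Types (x y : R) (m k l o : nat).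

Lemma measurable_unif_le x : measurable [set u : T | (u : R) <= x].
Proof.
apply: measurable_le_set; last exact: measurable_cst.
exact: measurable_id_unif.
Qed.

Lemma measurable_unif_lt x : measurable [set u : T | (u : R) < x].
Proof.
apply: measurable_lt_set; last exact: measurable_cst.
exact: measurable_id_unif.
Qed.

Lemma unif_lt x : 0 <= x <= 1 -> Pr P [set u : T | (u : R) < x] = x.
Proof.
move=> /andP[x0 x1].
have mx := measurable_unif_lt.
have m01 : measurable [set u : T | 0 <= (u : R) < 1].
  rewrite [X in measurable X](_ : _ = ~` [set u : T | (u : R) < 0] `&`
     [set u : T | (u : R) < 1]).
    by apply: measurableI => //; exact: measurableC.
  apply/seteqP; split => u /= => [/andP[? ->]|[]]; rewrite ltNge.
    by split => //; apply/negP; rewrite negbK.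
  by move=> /negP; rewrite negbK => -> ->.
rewrite -(PrI_full (mx x) m01 (unif01 R)) -[RHS]subr0 -unif_itv//.
congr (Pr P _); apply/seteqP; split => u /= => [[-> /andP[->]]//|/andP[u0 ux]].
by rewrite ux u0; split => //; exact: lt_le_trans x1.
Qed.

Let clip x : R := Num.max 0 (Num.min x 1).

Let clipE x : clip x = if x < 0 then 0 else if x <= 1 then x else 1.
Proof.
rewrite /clip maxEle minEle.
case: (leP x 1) => h1; last by rewrite ler01 ltNge (ltW (lt_trans ltr01 h1)).
by case: (ltP x 0) => // h0; rewrite ?h0// leNgt h0.
Qed.

Lemma unif_le x : Pr P [set u : T | (u : R) <= x] = clip x.
Proof.
have mx := measurable_unif_lt; have mlx := measurable_unif_le.
rewrite clipE; case: ifP => [x0|/negbT]; last first.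
  rewrite -leNgt => x0; case: (leP x 1) => [x1|x1]; last first.
    apply/eqP; rewrite eq_le Pr_le1//= -[leLHS](@unif_lt 1) ?ler01 ?lexx//.
    by apply: le_Pr => // u /= u1; rewrite ltW// (lt_trans u1).
  have x01 : 0 <= x <= 1 by rewrite x0 x1.
  apply/eqP; rewrite eq_le; apply/andP; split; last first.
    by rewrite -[leLHS]unif_lt//; apply: le_Pr => // u /=; exact: ltW.
  have [->|x1'] := eqVneq x 1; first exact: Pr_le1.
  have {}x1 : x < 1 by rewrite lt_neqAle x1'.
  apply/ler_addgt0Pr => e e0.
  (* The closed ray is approximated by open ones from the right. *)
pose y := Num.min (x + e) 1.
  have xy : x < y by rewrite lt_min x1 ltrDl e0.
  have y01 : 0 <= y <= 1.
    by rewrite (le_trans x0 (ltW xy))/= ge_min lexx orbT.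
  apply: (@le_trans _ _ y); last by rewrite ge_min lexx.
  rewrite -[leRHS]unif_lt//; apply: le_Pr => // u /= ux.
  exact: le_lt_trans xy.
apply/eqP; rewrite eq_le Pr_ge0 andbT.
rewrite -[leRHS](@unif_lt 0) ?lexx ?ler01//.
by apply: le_Pr => // u /= ux; exact: le_lt_trans x0.
Qed.

Lemma subunif_joint_le x y :
  Pr P ([set u : T | subunif 0 (u : R) <= x] `&`
        [set u : T | subunif 1 (u : R) <= y]) = clip x * clip y.
Proof.
have red o z : [set u : T | subunif o (u : R) <= z] =
    if z < 0 then set0 else [set u : T | subunif o (u : R) <= clip z].
  rewrite clipE; case: ifP => [z0|zn0].
    rewrite -subset0 => u /= uz.
    by have := le_lt_trans uz z0; rewrite ltNge subunif_ge0.
  rewrite zn0; case: ifP => // z1; apply/seteqP; split => u /= _; first exact: subunif_le1.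
  by rewrite (le_trans (subunif_le1 _ _))// ltW// ltNge z1.
have clip01 z : 0 <= clip z <= 1.
  by rewrite clipE; case: (ltP z 0) => ?; case: (leP z 1) => ?; lra.
have clip0 z : z < 0 -> clip z = 0 by rewrite clipE => ->.
rewrite (red 0%N x) (red 1%N y); case: ifP => [/clip0 ->|_].
  by rewrite set0I Pr_set0 mul0r.
case: ifP => [/clip0 ->|_]; first by rewrite setI0 Pr_set0 mulr0.
exact: subunif_box.
Qed.

(** One uniform variable contains two independent uniform variables. Iterating
    this on the second of them produces an infinite independent sequence with
    no product space of infinitely many factors. *)
Lemma subunif_split A B : measurable A -> measurable B ->
  Pr P ([set u : T | A (subunif 0 (u : R))] `&` [set u : T | B (subunif 1 (u : R))])
  = Pr P A * Pr P B.
Proof.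
move=> mA mB.
have mU o := @measurable_subunif R o.
have le1 : clip 1 = 1 by rewrite clipE ltr10 lexx.
have full o : [set u : T | subunif o (u : R) <= 1] = setT.
  by apply/seteqP; split => u //= _; exact: subunif_le1.
have marg0 x : Pr P [set u : T | subunif 0 (u : R) <= x] = clip x.
  by have := subunif_joint_le x 1; rewrite full setIT le1 mulr1.
have marg1 x : Pr P [set u : T | subunif 1 (u : R) <= x] = clip x.
  by have := subunif_joint_le 1 x; rewrite full setTI le1 mul1r.
have step y : Pr P ([set u : T | subunif 1 (u : R) <= y] `&`
                    (fun u : T => subunif 0 (u : R)) @^-1` A)
            = clip y * Pr P A.
  rewrite -marg1.
  apply: (@real_product_rule R _ T P _ T P (fun u => subunif 0 (u : R))
     (fun u => u : R)) => //.
    exact: measurable_subunif_le.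
  by move=> x; rewrite setIC subunif_joint_le marg1 unif_le mulrC.
have PA : Pr P [set u : T | A (subunif 0 (u : R))] = Pr P A.
  by have := step 1; rewrite full setTI le1 mul1r.
rewrite -PA.
apply: (@real_product_rule R _ T P _ T P (fun u => subunif 1 (u : R))
     (fun u => u : R)) => //.
  exact: measurable_preimageT (mU 0%N) mA.
by move=> x; rewrite PA setIC step unif_le mulrC.
Qed.

Fixpoint unifseq (i : nat) (u : R) : R :=
  if i is j.+1 then unifseq j (subunif 1 u) else subunif 0 u.

Lemma measurable_unifseq i : measurable_fun [set: T] (fun u : T => unifseq i (u : R)).
Proof.
elim: i => [|i IH]; first exact: measurable_subunif.
exact: (measurableT_comp IH (@measurable_subunif R 1)).
Qed.

Lemma unifseq_iid n (A : nat -> set R) : (forall i, measurable (A i)) ->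
  Pr P [set u : T | forall i, (i < n)%N -> A i (unifseq i (u : R))] =
  \prod_(i < n) Pr P (A i).
Proof.
elim: n A => [|n IH] A mA.
  by rewrite big_ord0 -(Pr_setT P); congr Pr; apply/seteqP; split.
rewrite big_ord_recl -(IH (fun i => A i.+1))// -subunif_split//; last first.
  apply: (@measurable_forall_lt _ T (fun i => [set u : T | A i.+1 (unifseq i (u : R))])).
  by move=> i _; exact: measurable_preimageT (measurable_unifseq i) (mA i.+1).
congr Pr; apply/seteqP; split => u /=.
  by move=> H; split => [|i ni]; [exact: (H 0%N)|exact: (H i.+1)].
by move=> [H0 H] [|i] //; exact: H.
Qed.

(** Outside of (0, 1), a null set, the value is an arbitrary positive number,
    so that exponential variables are positive at every point of the space. *)
Definition expo_of (u : R) : R := if (0 < u) && (u < 1) then - ln u else 1.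

Definition expseq (i : nat) (u : T) : R := expo_of (unifseq i (u : R)).

Lemma expo_of_gt0 u : 0 < expo_of u.
Proof.
rewrite /expo_of; case: ifP => // /andP[u0 u1].
by rewrite oppr_gt0 ln_lt0// u0.
Qed.

Lemma measurable_expo_of : measurable_fun [set: R] expo_of.
Proof.
apply: measurable_fun_ifT.
- by apply: measurable_and; apply: measurable_fun_ltr => //; exact: measurable_cst.
- by apply: measurableT_comp => //; exact: measurable_ln.
- exact: measurable_cst.
Qed.

Lemma measurable_expseq i : measurable_fun [set: T] (expseq i).
Proof. exact: (measurableT_comp measurable_expo_of (measurable_unifseq i)). Qed.

Lemma expo_of_tail x : 0 <= x -> Pr P [set u : T | x < expo_of (u : R)] = expR (- x).
Proof.
move=> x0.
have e01 : 0 <= expR (- x) <= 1 by rewrite expR_ge0 -expR0 ler_expR oppr_le0.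
have mx := measurable_unif_lt; have mlx := measurable_unif_le.
rewrite -[RHS]unif_lt//.
pose I := ~` [set u : T | (u : R) <= 0] `&` [set u : T | (u : R) < 1].
have mI : measurable I by apply: measurableI => //; exact: measurableC.
have I1 : Pr P I = 1.
  rewrite /I PrI_full ?unif_lt ?ler01 ?lexx//; last exact: measurableC.
  by rewrite Pr_setC// unif_le clipE ltxx ler01 subr0.
have mE : measurable [set u : T | x < expo_of (u : R)].
  apply: measurable_lt_set; first exact: measurable_cst.
  exact: (measurableT_comp measurable_expo_of (@measurable_id_unif R)).
rewrite -(PrI_full mE mI I1) -(PrI_full (mx (expR (- x))) mI I1).
congr Pr; apply/seteqP; split => u /= [+ Iu]; move: (Iu) => [/negP + u1];
  rewrite -ltNge => u0; rewrite /expo_of u0 u1/= => h; split => //.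
  by rewrite -[ltLHS]lnK ?posrE// ltr_expR ltrNr.
by rewrite ltrNr -ltr_expR lnK ?posrE.
Qed.

Lemma expseq_iid n (A : nat -> set R) : (forall i, measurable (A i)) ->
  Pr P [set u : T | forall i, (i < n)%N -> A i (expseq i u)] =
  \prod_(i < n) Pr P [set u : T | A i (expo_of (u : R))].
Proof.
move=> mA; apply: (@unifseq_iid n (fun i => [set u : R | A i (expo_of u)])) => i.
exact: measurable_preimageT measurable_expo_of (mA i).
Qed.

Lemma expo_of_law A : measurable A ->
  P [set u : T | A (expo_of (u : R))] = exponential_prob 1 A.
Proof.
move=> mA.
have mE : measurable_fun [set: T] (fun u : T => expo_of (u : R)).
  exact: (measurableT_comp measurable_expo_of (@measurable_id_unif R)).
have one0 : (0 : R) < 1 by exact: ltr01.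
pose Qof : probability T R := exponential_prob (1 : R).
pose Q := Qof one0.
have mid := @measurable_id_unif R.
have Q_le x : 0 < x -> Pr Q [set u : T | (u : R) <= x] = 1 - expR (- x).
  move=> x0.
  rewrite (_ : [set u | _] = [set u : T | (u : R) < 0] `|` `[0, x]%classic).
    rewrite PrU //; last 2 first.
    - exact: measurable_unif_lt.
    - rewrite -subset0 => u /= []; rewrite in_itv/= => + /andP[u0 _].
      by rewrite ltNge u0.
    rewrite [X in _ + X](_ : _ = 1 - expR (- x)); last first.
      by rewrite /Pr [X in fine X]exponential_prob_itv0c// mulN1r.
    rewrite [X in X + _](_ : _ = 0) ?add0r//.
    rewrite /Pr [X in fine X](_ : _ = 0%E)//.
    apply: integral0_eq => u /= u0.
    by rewrite lt0_exponential_pdf.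
  apply/seteqP; split => u /=; rewrite in_itv/=.
    by move=> ux; case: (ltP (u : R) 0) => u0; [left|right; rewrite ux].
  by move=> [u0|/andP[]//]; rewrite ltW// (lt_trans u0).
have mle x := @measurable_unif_le x.
have := @real_product_rule R _ T P _ T Q _ (fun u => u : R) setT mE mid measurableT.
rewrite Pr_setT => /(_ _ A mA); rewrite mul1r setTI => H.
rewrite PrE; last exact: measurable_preimageT mE mA.
rewrite [RHS](_ : _ = (Pr Q A)%:E); last by rewrite -PrE.
congr EFin; apply: H => x; rewrite mul1r setTI.
have [x0|x0] := ltP 0 x.
  rewrite Q_le// -(expo_of_tail (ltW x0)).
  rewrite -Pr_setC; last by apply: measurable_lt_set => //; exact: measurable_cst.
  by congr Pr; apply/seteqP; split => u /=; rewrite leNgt => /negP.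
rewrite (_ : [set u | _] = set0) ?Pr_set0; last first.
  rewrite -subset0 => u /= ux; have := expo_of_gt0 u.
  by rewrite ltNge (le_trans ux).
apply/esym/eqP; rewrite eq_le Pr_ge0 andbT.
apply/ler_addgt0Pr => e e0; rewrite add0r.
apply: (@le_trans _ _ (Pr Q [set u : T | (u : R) <= e])).
  by apply: le_Pr => // u /= ux; rewrite (le_trans ux)// (le_trans x0)// ltW.
by rewrite Q_le//; have := expR_ge1Dx (- e); lra.
Qed.

End iid.

(** * Exponential clocks in a race *)

(** Cutting the interval into [n] equal pieces leaves an error of order [1 /
    n]. Applied to the difference between a probability and its expected value,
    this replaces integration: only increments over a short interval have to be
    estimated, and only up to second order. *)
Lemma eq_quadratic_increments (R : realType) (D : R -> R) (a b K : R) : a <= b ->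
  (forall s t, a <= s -> s <= t -> t <= b -> `|D t - D s| <= K * (t - s) ^+ 2) ->
  D a = D b.
Proof.
move=> ab HD; set l := b - a.
have l0 : 0 <= l by rewrite subr_ge0.
have bound n : `|D b - D a| * n.+1%:R <= K * l ^+ 2.
  (* Each of the n + 1 steps contributes at most K h ^ 2, and (n + 1) h = l. *)
  pose h := l / n.+1%:R.
  have n0 : 0 < n.+1%:R :> R by [].
  have h0 : 0 <= h by rewrite divr_ge0.
  have hn : n.+1%:R * h = l by rewrite mulrC divfK ?gt_eqF.
  have step i : (i <= n.+1)%N ->
      `|D (a + i%:R * h) - D a| <= i%:R * (K * h ^+ 2).
    elim: i => [_|i IH ni]; first by rewrite !mul0r addr0 subrr normr0.
    have ih0 : 0 <= i%:R * h by rewrite mulr_ge0.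
    have e : a + i.+1%:R * h - (a + i%:R * h) = h by rewrite -natr1; ring.
    have le : a + i.+1%:R * h <= b.
      by rewrite -lerBrDl -/l -hn ler_wpM2r// ler_nat.
    have hi := HD (a + i%:R * h) (a + i.+1%:R * h).
    rewrite e in hi.
    have {}hi := hi ltac:(lra) ltac:(by rewrite -natr1; lra) le.
    have -> : i.+1%:R * (K * h ^+ 2) = K * h ^+ 2 + i%:R * (K * h ^+ 2).
      by rewrite -natr1; ring.
    rewrite (_ : _ - D a = (D (a + i.+1%:R * h) - D (a + i%:R * h)) +
       (D (a + i%:R * h) - D a)); last by ring.
    by apply: le_trans (ler_normD _ _) _; rewrite lerD// IH// ltnW.
  have := step _ (leqnn _); rewrite hn (_ : a + l = b); last by rewrite /l; ring.
  move=> H; have -> : K * l ^+ 2 = n.+1%:R * (K * h ^+ 2) * n.+1%:R.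
    by rewrite -hn; ring.
  by rewrite ler_wpM2r.
apply/eqP; rewrite -subr_eq0 -normr_le0 -normrN opprB leNgt; apply/negP => e0.
have := bound (Num.truncn (K * l ^+ 2 / `|D b - D a|)).
by rewrite leNgt -ltr_pdivrMl// mulrC truncnS_gt.
Qed.

Section expR_bounds.
Variable R : realType.
Implicit Types h : R.

Lemma sub1_expRN_le h : 1 - expR (- h) <= h.
Proof. by have := expR_ge1Dx (- h); lra. Qed.

Lemma sub1_expRN_ge h : 0 <= h -> h - h ^+ 2 <= 1 - expR (- h).
Proof.
move=> h0; have := expR_ge1Dx h => H.
have h1 : 0 < 1 + h by lra.
have : expR (- h) <= (1 + h)^-1 by rewrite expRN lef_pV2// posrE expR_gt0.
have : (1 + h)^-1 <= 1 - h + h ^+ 2.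
  rewrite -[leLHS]mul1r ler_pdivrMr//.
  rewrite (_ : (1 - h + h ^+ 2) * (1 + h) = 1 + h ^+ 3); last by ring.
  by rewrite lerDl exprn_ge0.
lra.
Qed.

Lemma sub1_expRN_ge0 h : 0 <= h -> 0 <= 1 - expR (- h).
Proof. by move=> h0; rewrite subr_ge0 -expR0 ler_expR oppr_le0. Qed.

End expR_bounds.

Section race.
Context d (T : measurableType d) (R : realType) (Q : probability T R).

Lemma Pr_slice (X : T -> R) (A : set T) s t :
  measurable_fun setT X -> measurable A -> s <= t ->
  Pr Q ([set w | s < X w] `&` A) - Pr Q ([set w | t < X w] `&` A) =
  Pr Q ([set w | s < X w <= t] `&` A).
Proof.
move=> mX mA st.
have mgt (u : R) : measurable [set w | u < X w].
  by apply: measurable_lt_set => //; exact: measurable_cst.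
have ms : measurable ([set w | s < X w] `&` A) by exact: measurableI.
rewrite (PrDI Q ms (mgt t)).
have -> : [set w | s < X w] `&` A `&` [set w | t < X w] = [set w | t < X w] `&` A.
  apply/seteqP; split => w /=; first by tauto.
  by move=> [tX Aw]; do !split => //; exact: le_lt_trans tX.
rewrite addrAC subrr add0r; congr (Pr Q _).
apply/seteqP; split => w /=.
  by move=> [[-> Aw] /negP]; rewrite -leNgt.
by move=> [/andP[-> Xt] Aw]; split => //; apply/negP; rewrite -leNgt.
Qed.

(** The exponential variable [X] of rate 1 races against a constraint that
    survives up to level [u] with probability [expR (- (b * u))], as the
    minimum of independent exponential clocks of total rate [b] does: [X] comes
    first with probability [1 / (1 + b)], and then it has rate [1 + b]. No
    joint density is needed, since on the slice where [X] is in [(x, y]] the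
    random constraint [B (X w)] lies between [B y] and [B x]. *)
Lemma exponential_race (X : T -> R) (B : R -> set T) (C b : R) :
  measurable_fun setT X -> (forall u, measurable (B u)) ->
  measurable [set w | B (X w) w] -> (forall u v, u <= v -> B v `<=` B u) ->
  0 <= C -> 0 <= b ->
  (forall s u, 0 <= s -> 0 <= u ->
    Pr Q ([set w | s < X w] `&` B u) = C * expR (- s) * expR (- (b * u))) ->
  forall s, 0 <= s ->
    Pr Q ([set w | s < X w] `&` [set w | B (X w) w]) =
    C * expR (- ((1 + b) * s)) / (1 + b).
Proof.
move=> mX mB mBX Banti C0 b0 HB s s0.
set BX := [set w | B (X w) w] in mBX *.
have mgt (u : R) : measurable [set w | u < X w].
  by apply: measurable_lt_set => //; exact: measurable_cst.
pose f x := Pr Q ([set w | x < X w] `&` BX).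
pose A := 1 + b; have A0 : 0 < A by rewrite /A; lra.
pose F x := C * expR (- (A * x)) / A.
pose D x := f x - F x.
(* On a slice the constraint at the random level is squeezed between the
   constraints at the two ends. *)
have slice_f x y : 0 <= x -> x <= y ->
    C * (expR (- x) - expR (- y)) * expR (- (b * y)) <= f x - f y <=
    C * (expR (- x) - expR (- y)) * expR (- (b * x)).
  move=> x0 xy; have y0 := le_trans x0 xy.
  rewrite /f Pr_slice//.
  have E u : 0 <= u -> C * (expR (- x) - expR (- y)) * expR (- (b * u)) =
      Pr Q ([set w | x < X w <= y] `&` B u).
    by move=> u0; rewrite -Pr_slice// !HB//; ring.
  have ms : measurable [set w | x < X w <= y].
    rewrite [X in measurable X](_ : _ = [set w | x < X w] `\` [set w | y < X w]).
      exact: measurableD.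
    apply/seteqP; split => w /=.
      by move=> /andP[-> Xy]; split => //; apply/negP; rewrite -leNgt.
    by move=> [-> /negP]; rewrite -leNgt.
  rewrite !E//; apply/andP; split; apply: le_Pr; try exact: measurableI.
    by move=> w /= [/andP[-> Xy]] BX_; split => //; exact: Banti BX_.
  by move=> w /= [/andP[xX ->]] BX_; rewrite xX; split => //; apply: Banti BX_; rewrite ltW.
have DL L : s <= L -> D s = D L.
  move=> sL; apply: (@eq_quadratic_increments _ _ _ _ (C * A)) => // x y sx xy _.
  have x0 : 0 <= x by exact: le_trans sx.
  have h0 : 0 <= y - x by rewrite subr_ge0.
  set h := y - x in h0 *.
  have yE : y = x + h by rewrite /h; ring.
  have /andP[lo up] := slice_f x y x0 xy.
  have eA : expR (- (A * x)) = expR (- x) * expR (- (b * x)).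
    by rewrite -expRD; congr expR; rewrite /A; ring.
  have ey : expR (- y) = expR (- x) * expR (- h).
    by rewrite -expRD yE; congr expR; ring.
  have eby : expR (- (b * y)) = expR (- (b * x)) * expR (- (b * h)).
    by rewrite -expRD yE; congr expR; ring.
  have eAy : expR (- (A * y)) = expR (- (A * x)) * expR (- (A * h)).
    by rewrite -expRD yE; congr expR; ring.
  set G := C * expR (- (A * x)).
  have G0 : 0 <= G by rewrite mulr_ge0// expR_ge0.
  have GC : G <= C.
    by rewrite -[leRHS]mulr1 ler_wpM2l// -expR0 ler_expR oppr_le0 mulr_ge0// ltW.
  have up' : f x - f y <= G * h.
    apply: le_trans up _; rewrite ey /G eA.
    rewrite (_ : _ * _ * _ = C * (expR (- x) * expR (- (b * x))) * (1 - expR (- h))); last by ring.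
    by rewrite ler_wpM2l -?eA// sub1_expRN_le.
  have lo' : G * (h - A * h ^+ 2) <= f x - f y.
    apply: le_trans lo; rewrite ey eby /G eA.
    rewrite (_ : C * _ * (_ * expR (- (b * h))) =
       C * (expR (- x) * expR (- (b * x))) *
       ((1 - expR (- h)) * expR (- (b * h)))); last by ring.
    rewrite ler_wpM2l -?eA//.
    have := sub1_expRN_ge h0; have := sub1_expRN_le h; have := sub1_expRN_ge0 h0.
    have := sub1_expRN_le (b * h); have := sub1_expRN_ge0 (mulr_ge0 b0 h0).
    move: (expR _) (expR _) => p q; rewrite /A => q0 q1 p0 p1 p2.
    have : (1 - q) * (1 - p) <= (b * h) * h by apply: ler_pM.
    nra.
  have upF : F x - F y <= G * h.
    rewrite /F eAy (_ : _ - _ = G * ((1 - expR (- (A * h))) / A)).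
      by rewrite ler_wpM2l// ler_pdivrMr// mulrC sub1_expRN_le.
    by rewrite /G; ring.
  have loF : G * (h - A * h ^+ 2) <= F x - F y.
    rewrite /F eAy (_ : F x - _ = G * ((1 - expR (- (A * h))) / A)).
      rewrite ler_wpM2l// ler_pdivlMr//.
      by have := sub1_expRN_ge (mulr_ge0 (ltW A0) h0); nra.
    by rewrite /G/F; ring.
  have GA : G * (A * h ^+ 2) <= C * A * h ^+ 2.
    by rewrite -mulrA ler_wpM2r// mulr_ge0 ?exprn_ge0// ltW.
  by rewrite /D ler_norml; apply/andP; split; move: lo' loF; rewrite mulrBr; lra.
(* Both f and F vanish at infinity, so a D that is constant is zero. *)
have small L : s <= L -> `|D L| <= 2 * C * expR (- L).
  move=> sL; have L0 : 0 <= L by exact: le_trans sL.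
  have f0 : 0 <= f L by exact: Pr_ge0.
  have fC : f L <= C * expR (- L).
    have -> : C * expR (- L) = Pr Q ([set w | L < X w] `&` B 0).
      by rewrite HB// mulr0 oppr0 expR0 mulr1.
    apply: le_Pr; try exact: measurableI.
    by move=> w /= [LX]; move=> BX_; split => //; apply: Banti BX_; lra.
  have F0 : 0 <= F L by rewrite divr_ge0 ?mulr_ge0 ?expR_ge0 ?(ltW A0).
  have FC : F L <= C * expR (- L).
    rewrite ler_pdivrMr// -mulrA ler_wpM2l//.
    apply: (@le_trans _ _ (expR (- L))); first by rewrite ler_expR lerN2 /A; nra.
    by rewrite ler_peMr ?expR_ge0// /A; lra.
  by rewrite ler_norml /D; apply/andP; split; lra.
suff : D s = 0 by rewrite /D => /eqP; rewrite subr_eq0 => /eqP.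
apply/eqP; rewrite -normr_le0 leNgt; apply/negP => e0.
set e := `|D s| in e0.
(* From here on expR (- L) <= 1 / (1 + L), so this L gives a bound below e. *)
pose L := s + 2 * C / e.
have sL : s <= L by rewrite lerDl divr_ge0 ?mulr_ge0// ltW.
have := small L sL; rewrite -DL// -/e leNgt => /negP; apply.
have L1 : 0 < 1 + L by lra.
apply: (@le_lt_trans _ _ (2 * C / (1 + L))).
  rewrite ler_wpM2l ?mulr_ge0// expRN lef_pV2 ?posrE ?expR_gt0//.
  exact: expR_ge1Dx.
rewrite ltr_pdivrMr// /L.
have -> : e * (1 + (s + 2 * C / e)) = e * (1 + s) + 2 * C.
  by field; rewrite gt_eqF.
by rewrite ltrDr mulr_gt0//; lra.
Qed.

End race.

Section selection.
Variables (R : realType) (S : finType) (z0 : S).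
Implicit Types (g r : S -> R) (z y : S) (f : R).

(** The clock of [z] runs at speed [g z], so it rings at time [r z / g z]; [z]
    wins when it rings strictly first. Clearing denominators covers the clocks
    that stand still. *)
Definition wins g r z : bool :=
  (0 < g z) && [forall y, (y != z) ==> (r z * g y < r y * g z)].

(** When clocks tie, an event of probability zero, the default state [z0] is
    declared the winner, with waiting time 0. *)
Definition winner g r : S := odflt z0 [pick z | wins g r z].

Definition wait_time g r : R :=
  if wins g r (winner g r) then r (winner g r) / g (winner g r) else 0.

(** What is left on the clocks when the first one rings; the clock that rang is
    set anew to [f]. *)
Definition residual g r f y : R :=
  if y == winner g r then f else r y - wait_time g r * g y.

Lemma wins_winner g r z : wins g r z -> winner g r = z.
Proof.
rewrite /winner; case: pickP => [y /= yw zw|/(_ z) -> //].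
apply/eqP; apply/negPn/negP => yz.
case/andP: yw => _ /forallP/(_ z); rewrite eq_sym yz /= => h1.
case/andP: zw => _ /forallP/(_ y); rewrite yz /= => h2.
by have := lt_trans h1 h2; rewrite ltxx.
Qed.

Lemma wait_time_ge0 g r : (forall y, 0 < r y) -> 0 <= wait_time g r.
Proof.
move=> r0; rewrite /wait_time; case: ifP => // /andP[g0 _].
by rewrite divr_ge0 ?ltW.
Qed.

Lemma wait_time_wins g r : 0 < wait_time g r -> wins g r (winner g r).
Proof. by rewrite /wait_time; case: ifP => //; rewrite ltxx. Qed.

(** Clocks stay positive even when a tie has occurred. Hence events that only
    involve the states and the waiting times need no condition on the clocks.
    *)
Lemma residual_gt0 g r f : (forall y, 0 < r y) -> 0 < f ->
  forall y, 0 < residual g r f y.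
Proof.
move=> r0 f0 y; rewrite /residual; case: ifP => // /negbT yz.
rewrite /wait_time; case: ifP => [/andP[g0 /forallP/(_ y)]|_].
  by rewrite yz /= => h; rewrite subr_gt0 mulrAC ltr_pdivrMr.
by rewrite mul0r subr0.
Qed.

End selection.

Section one_step.
Variables (R : realType) (S : finType) (z0 : S).
Context d (T : measurableType d) (Q : probability T R).

Lemma measurable_wins (g : S -> R) (r : S -> T -> R) z :
  (forall y, measurable_fun setT (r y)) ->
  measurable [set w | wins g (fun y => r y w) z].
Proof.
move=> mr; case: (ltP 0 (g z)) => g0; last first.
  rewrite [X in measurable X](_ : _ = set0)// -subset0 => w /= /andP[+ _].
  by rewrite ltNge g0.
rewrite [X in measurable X](_ : _ = [set w | forall y,
   (if y == z then setT else [set w | r z w * g y < r y w * g z]) w]).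
  apply: (@measurable_forall_fin _ _ _ (fun y => if y == z then setT else
      [set w | r z w * g y < r y w * g z])) => y.
  case: ifP => // _.
  apply: measurable_lt_set; apply: measurable_funM => //; exact: measurable_cst.
apply/seteqP; split => w /=.
  by move=> /andP[_ /forallP H] y; have := H y; case: eqP.
move=> H; rewrite /wins g0; apply/forallP => y; apply/implyP => yz.
by have := H y; rewrite (negbTE yz).
Qed.

Lemma measurable_winner (g : S -> R) (r : S -> T -> R) z :
  (forall y, measurable_fun setT (r y)) ->
  measurable [set w | winner z0 g (fun y => r y w) = z].
Proof.
move=> mr; have mw y := measurable_wins g y mr.
rewrite [X in measurable X](_ : _ = [set w | wins g (fun y => r y w) z] `|`
   (~` [set w | exists y, wins g (fun y => r y w) y] `&`
    (if z == z0 then setT else set0))).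
  apply: measurableU => //; apply: measurableI; last by case: ifP.
  apply: measurableC.
  exact: (@measurable_exists_count _ _ _ (fun y => [set w | wins g (fun y => r y w) y])).
apply/seteqP; split => w /=.
  rewrite /winner; case: pickP => [y yw /= <-|H /= <-]; first by left.
  by right; rewrite eqxx; split => // -[y]; rewrite H.
move=> [/wins_winner -> //|[H]]; case: eqP => // -> _.
by rewrite /winner; case: pickP => // y yw; case: H; exists y.
Qed.

(** Lack of memory. Clocks that are independent exponentials given [H] produce
    a winner of law [g], an exponential waiting time, and residual clocks that
    are again independent exponentials, all independent. This follows from
    [exponential_race] for the clock of [z] against the requirement that the
    others hold out until it rings and then still have the amounts [a] left,
    whose total rate relative to that clock is [(1 - g z) / g z]. *)
Lemma step_law (g : S -> R) (r : S -> T -> R) (f : T -> R) (H : set T)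
    (C : R) (z : S) (x : R) (a : S -> R) :
  prob_vector g ->
  (forall y, measurable_fun setT (r y)) -> measurable_fun setT f ->
  measurable H -> 0 <= C ->
  (forall (a' : S -> R) b, (forall y, 0 <= a' y) -> 0 <= b ->
    Pr Q (H `&` [set w | (forall y, a' y < r y w) /\ b < f w]) =
    C * expR (- \sum_y a' y) * expR (- b)) ->
  0 <= x -> (forall y, 0 <= a y) ->
  Pr Q (H `&` [set w | [/\ winner z0 g (fun y => r y w) = z,
                          x < wait_time z0 g (fun y => r y w) &
       forall y, a y < residual z0 g (fun y => r y w) (f w) y]]) =
  C * (g z * expR (- x)) * expR (- \sum_y a y).
Proof.
move=> [g0 g1] mr mf mH C0 Hr x0 a0.
have [gz0|gz] := leP (g z) 0.
  have -> : g z = 0 by apply/eqP; rewrite eq_le gz0 g0.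
  rewrite mul0r mulr0 mul0r (_ : _ `&` _ = set0) ?Pr_set0// -subset0.
  move=> w /= [_ [wz xt _]]; have := wait_time_wins (le_lt_trans x0 xt).
  by rewrite wz => /andP[+ _]; rewrite ltNge gz0.
(* The level u is the value of the clock of z: then clock y has run down by g y
   / g z * u. At y = z the inequality reads -1 < 0 and is void. *)
pose B u := H `&` [set w | (forall y, (if y == z then -1 else g y / g z * u + a y)
   < (if y == z then 0 else r y w)) /\ a z < f w].
pose b := \sum_(y | y != z) g y / g z.
have b0 : 0 <= b by apply: sumr_ge0 => y _; rewrite divr_ge0// ltW.
have bE : 1 + b = (g z)^-1.
  rewrite /b -mulr_suml; have -> : \sum_(y | y != z) g y = 1 - g z.
    by rewrite -g1 [in RHS](bigD1 z)//= addrAC subrr add0r.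
  by field; rewrite gt_eqF.
pose C' := C * expR (- a z) * expR (- \sum_(y | y != z) a y).
have C'0 : 0 <= C' by rewrite !mulr_ge0// expR_ge0.
have mB' (h : T -> R) : measurable_fun setT h ->
    measurable (H `&` [set w | (forall y,
       (if y == z then -1 else g y / g z * h w + a y)
         < (if y == z then 0 else r y w)) /\ a z < f w]).
  move=> mh; apply: measurableI => //.
  apply: (@measurableI _ _ [set w | forall y, _ < _] [set w | a z < f w]).
    apply: (@measurable_forall_fin _ _ _ (fun y => [set w |
       (if y == z then -1 else g y / g z * h w + a y)
         < (if y == z then 0 else r y w)])) => y.
    case: eqP => _; apply: measurable_lt_set => //; try exact: measurable_cst.
    apply: measurable_funD; last exact: measurable_cst.
    by apply: measurable_funM => //; exact: measurable_cst.
  by apply: measurable_lt_set => //; exact: measurable_cst.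
have race : forall s, 0 <= s ->
    Pr Q ([set w | s < r z w] `&` [set w | B (r z w) w]) =
    C' * expR (- ((1 + b) * s)) / (1 + b).
  apply: exponential_race => //.
  - by move=> u; apply: mB'; exact: measurable_cst.
  - exact: mB' (mr z).
  - move=> u v uv w [Hw [hw fw]]; split => //; split => // y.
    have := hw y; case: eqP => // _; apply: le_lt_trans.
    by rewrite lerD2r ler_wpM2l// divr_ge0// ltW.
  - move=> s u s0 u0.
    pose a' y := if y == z then s else g y / g z * u + a y.
    have a'0 y : 0 <= a' y.
      by rewrite /a'; case: ifP => // _; rewrite addr_ge0// mulr_ge0// divr_ge0// ltW.
    rewrite (_ : _ `&` _ = H `&` [set w | (forall y, a' y < r y w) /\ a z < f w]).
      rewrite Hr// (bigD1 z)//= {1}/a' eqxx.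
      rewrite (eq_bigr (fun y => g y / g z * u + a y)); last first.
        by move=> y yz; rewrite /a' (negbTE yz).
      rewrite big_split/= -mulr_suml -/b /C' !opprD !expRD; ring.
    apply/seteqP; split => w /=.
      move=> [sw [Hw [h fw]]]; split => //; split => // y.
      by have := h y; rewrite /a'; case: eqP => // ->.
    move=> [Hw [h fw]]; split; first by have := h z; rewrite /a' eqxx.
    split => //; split => // y; have := h y; rewrite /a'; case: eqP => //.
have gzx : 0 <= g z * x by rewrite mulr_ge0// ltW.
rewrite (_ : H `&` _ = [set w | g z * x < r z w] `&` [set w | B (r z w) w]).
  rewrite race// bE mulKf ?gt_eqF// invrK /C' [in RHS](bigD1 z)//= opprD expRD.
  ring.
apply/seteqP; split => w /=.
  move=> [Hw [wz xt ha]]; have ww := wait_time_wins (le_lt_trans x0 xt).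
  move: xt; rewrite /wait_time ww wz ltr_pdivlMr// mulrC => xt; split => //.
  split => //; split; last by have := ha z; rewrite /residual wz eqxx.
  move=> y; case: eqP => [_|/eqP yz]; first by rewrite ltrN10.
  have := ha y; rewrite /residual wz (negbTE yz) /wait_time ww wz.
  by rewrite ltrBrDr addrC (_ : g y / g z * r z w = r z w / g z * g y)//; ring.
move=> [xt [Hw [h fw]]]; split => //.
have ww : wins g (fun y => r y w) z.
  rewrite /wins gz; apply/forallP => y; apply/implyP => yz.
  have := h y; rewrite (negbTE yz) => hy.
  have : g y / g z * r z w < r y w.
    by apply: le_lt_trans hy; rewrite lerDl.
  by rewrite mulrAC ltr_pdivrMr// mulrC.
have wz := wins_winner z0 ww.
have rt : wait_time z0 g (fun y => r y w) = r z w / g z.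
  by rewrite /wait_time wz ww.
split => //; first by rewrite rt ltr_pdivlMr// mulrC.
move=> y; rewrite /residual wz rt; case: eqP => [->//|/eqP yz].
have := h y; rewrite (negbTE yz) ltrBrDr.
by rewrite addrC (_ : g y / g z * r z w = r z w / g z * g y)//; ring.
Qed.

End one_step.

(** * Exploration of the clocks by a Markov chain *)

Section exploration.
Variables (R : realType) (S : finType) (z0 : S).
Variables (pi0 : S -> R) (p : S -> S -> R).
Variable T : Type.
Variables (E : S -> T -> R) (F : nat -> T -> R).

Definition rate (o : option S) : S -> R := if o is Some z then p z else pi0.

(** The clocks together with the last state that rang, which fixes the speeds
    of the next round; [None] stands for the start, with speeds [pi0]. *)
Fixpoint clocks (n : nat) (w : T) : (S -> R) * option S :=
  if n is m.+1 then
    let: (r, o) := clocks m w in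
    (residual z0 (rate o) r (F m w), Some (winner z0 (rate o) r))
  else (E ^~ w, None).

Definition state n w : S := winner z0 (rate (clocks n w).2) (clocks n w).1.

Definition waiting n w : R := wait_time z0 (rate (clocks n w).2) (clocks n w).1.

Definition previous (s : nat -> S) (n : nat) : option S :=
  if n is m.+1 then Some (s m) else None.

(** The factor that the [n]-th state contributes to the probability of the path
    [s]. *)
Definition trans (s : nat -> S) n : R := rate (previous s n) (s n).

Lemma clocksS n w : clocks n.+1 w =
  (residual z0 (rate (clocks n w).2) (clocks n w).1 (F n w), Some (state n w)).
Proof. by rewrite /state /=; case: (clocks n w). Qed.

Lemma clocks2 n w : (clocks n w).2 = previous (state ^~ w) n.
Proof. by case: n => // n; rewrite clocksS. Qed.

Lemma clocks_gt0 w : (forall y, 0 < E y w) -> (forall n, 0 < F n w) ->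
  forall n y, 0 < (clocks n w).1 y.
Proof.
move=> E0 F0; elim=> [//|n IH] y.
by rewrite clocksS /=; exact: residual_gt0.
Qed.

End exploration.
Arguments clocks : simpl never.

Section exploration_law.
Variables (R : realType) (S : finType) (z0 : S).
Variables (pi0 : S -> R) (p : S -> S -> R).
Hypotheses (hp : stochastic p) (hpi0 : prob_vector pi0).
Context d (T : measurableType d) (Q : probability T R).
Variables (E : S -> T -> R) (F : nat -> T -> R).
Hypotheses (mE : forall y, measurable_fun setT (E y))
           (mF : forall n, measurable_fun setT (F n)).
Hypotheses (E0 : forall y w, 0 < E y w) (F0 : forall n w, 0 < F n w).
Hypothesis law : forall k (a : S -> R) (b : nat -> R),
  (forall y, 0 <= a y) -> (forall i, 0 <= b i) ->
  Pr Q [set w | (forall y, a y < E y w) /\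
                (forall i, (i < k)%N -> b i < F i w)] =
  expR (- \sum_y a y) * expR (- \sum_(i < k) b i).

Local Notation rate := (rate pi0 p).
Local Notation clocks := (clocks z0 pi0 p E F).
Local Notation state := (state z0 pi0 p E F).
Local Notation waiting := (waiting z0 pi0 p E F).
Local Notation trans := (trans pi0 p).

Lemma rate_prob o : prob_vector (rate o).
Proof. by case: o => [z|]; [exact: hp|exact: hpi0]. Qed.

Lemma trans_ge0 s n : 0 <= trans s n.
Proof. by have [h _] := rate_prob (previous s n); exact: h. Qed.

Lemma measurable_clocks n :
  (forall y, measurable_fun setT (fun w => (clocks n w).1 y)) /\
  (forall o, measurable [set w | (clocks n w).2 = o]).
Proof.
elim: n => [|n [IHr IHo]].
  split=> [//|o]; rewrite /clocks/=; case: o => [z|].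
    by rewrite [X in measurable X](_ : _ = set0)// -subset0.
  by rewrite [X in measurable X](_ : _ = setT)//; apply/seteqP; split.
have mS oz : measurable [set w | ((clocks n w).2, state n w) = oz].
  case: oz => o z; rewrite [X in measurable X](_ : _ =
     [set w | (clocks n w).2 = o] `&`
     [set w | winner z0 (rate o) (fun y => (clocks n w).1 y) = z]).
    by apply: measurableI => //; exact: measurable_winner.
  by apply/seteqP; split => w /= [<- <-].
have mw o z : measurable [set w | wins (rate o) (fun y => (clocks n w).1 y) z].
  exact: measurable_wins.
split.
  move=> y.
  pose D w := ((clocks n w).2, state n w).
  pose f (oz : option S * S) w := if y == oz.2 then F n w else
    (clocks n w).1 y - (if wins (rate oz.1) (fun y => (clocks n w).1 y) oz.2 then
      (clocks n w).1 oz.2 / rate oz.1 oz.2 else 0) * rate oz.1 y.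
  rewrite (_ : (fun w => _) = fun w => f (D w) w); last first.
    by apply/funext => w; rewrite clocksS.
  apply: measurable_countable_case; first exact: mS.
  move=> [q z]; rewrite /f /=; case: eqP => // _.
  apply: measurable_funB => //; apply: measurable_funM; last exact: measurable_cst.
  apply: measurable_fun_ifT; last exact: measurable_cst.
    by apply: (measurable_fun_bool true); rewrite setTI; exact: mw.
  by apply: measurable_funM => //; exact: measurable_cst.
move=> [z|].
  rewrite [X in measurable X](_ : _ =
    [set w | exists o, ((clocks n w).2, state n w) = (o, z)]).
    exact: (@measurable_exists_count _ _ _ (fun o => [set w | _ = (o, z)])).
  apply/seteqP; split => w /=; rewrite clocksS /=.
    by move=> [<-]; exists (clocks n w).2.
  by move=> [q [_ ->]].
rewrite [X in measurable X](_ : _ = set0)// -subset0 => w /=.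
by rewrite clocksS.
Qed.

Lemma measurable_state n z : measurable [set w | state n w = z].
Proof.
have [mr mo] := measurable_clocks n.
rewrite [X in measurable X](_ : _ = [set w | exists o,
   ([set w | (clocks n w).2 = o] `&`
     [set w | winner z0 (rate o) (fun y => (clocks n w).1 y) = z]) w]).
  apply: measurable_exists_count => o; apply: measurableI => //.
  exact: measurable_winner.
apply/seteqP; split => w /=; first by exists (clocks n w).2.
by move=> [q [<-]].
Qed.

Lemma measurable_waiting n : measurable_fun setT (waiting n).
Proof.
have [mr mo] := measurable_clocks n.
pose D w := ((clocks n w).2, state n w).
pose f (oz : option S * S) w :=
  if wins (rate oz.1) (fun y => (clocks n w).1 y) oz.2 then
      (clocks n w).1 oz.2 / rate oz.1 oz.2 else 0.
rewrite (_ : waiting n = fun w => f (D w) w)//.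
apply: measurable_countable_case => [[q z]|[q z]].
  rewrite [X in measurable X](_ : _ =
     [set w | (clocks n w).2 = q] `&` [set w | state n w = z]).
    by apply: measurableI => //; exact: measurable_state.
  by apply/seteqP; split => w /= [<- <-].
apply: measurable_fun_ifT; last exact: measurable_cst.
  by apply: (measurable_fun_bool true); rewrite setTI; exact: measurable_wins.
by apply: measurable_funM => //; exact: measurable_cst.
Qed.

Lemma waiting_ge0 n w : 0 <= waiting n w.
Proof. by apply: wait_time_ge0; exact: clocks_gt0. Qed.

Lemma measurable_lt_cst (f : T -> R) (a : R) : measurable_fun setT f ->
  measurable [set w | a < f w].
Proof. by move=> mf; apply: measurable_lt_set => //; exact: measurable_cst. Qed.

Lemma eq_previous (s s' : nat -> S) n : (forall i, (i < n)%N -> s i = s' i) ->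
  previous s n = previous s' n.
Proof. by case: n => // n H /=; rewrite H. Qed.

(** By induction with [step_law]. The conditions on the future refreshments [F
    (n + i)] are carried along because one of them is used up in each round. *)
Lemma clocks_law n k (s : nat -> S) (x : nat -> R) (a : S -> R) (b : nat -> R) :
  (forall i, 0 <= x i) -> (forall y, 0 <= a y) -> (forall i, 0 <= b i) ->
  Pr Q [set w | [/\ forall i, (i < n)%N -> state i w = s i /\ x i < waiting i w,
                    forall y, a y < (clocks n w).1 y &
                    forall i, (i < k)%N -> b i < F (n + i) w]] =
  (\prod_(i < n) (trans s i * expR (- x i))) * expR (- \sum_y a y) *
    expR (- \sum_(i < k) b i).
Proof.
move=> x0; elim: n k a b => [|n IH] k a b a0 b0.
  rewrite big_ord0 mul1r -law//; congr (Pr Q _).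
  by apply/seteqP; split => w /=; [move=> []|move=> [? ?]; split].
pose H := [set w | forall i, (i < n)%N -> state i w = s i /\ x i < waiting i w] `&`
          [set w | forall i, (i < k)%N -> b i < F (n.+1 + i) w].
have mH : measurable H.
  apply: measurableI.
    apply: (@measurable_forall_lt _ _ (fun i => [set w | state i w = s i] `&`
       [set w | x i < waiting i w])) => i _.
    apply: measurableI; first exact: measurable_state.
    by apply: measurable_lt_cst; exact: measurable_waiting.
  apply: (@measurable_forall_lt _ _ (fun i => [set w | b i < F (n.+1 + i) w])).
  by move=> i _; exact: measurable_lt_cst.
pose g := rate (previous s n).
pose C := (\prod_(i < n) (trans s i * expR (- x i))) * expR (- \sum_(i < k) b i).
have C0 : 0 <= C.
  rewrite mulr_ge0 ?expR_ge0//; apply: prodr_ge0 => i _.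
  by apply: mulr_ge0; [exact: trans_ge0|exact: expR_ge0].
have HE w : H w -> (clocks n w).2 = previous s n.
  by move=> [h _]; rewrite clocks2; apply: eq_previous => i /h[].
have := @step_law R S z0 _ T Q g (fun y w => (clocks n w).1 y) (F n) H C (s n) (x n) a
   (rate_prob _) (measurable_clocks n).1 (mF n) mH C0 _ (x0 n) a0.
rewrite big_ord_recr/= -/g => step.
rewrite (_ : _ * _ * _ = C * (g (s n) * expR (- x n)) * expR (- \sum_y a y)); last first.
  by rewrite /C /trans -/g; ring.
rewrite -step.
  congr (Pr Q _); apply/seteqP; split => w /=.
    move=> [h1 h2 h3]; have Hw : H w.
      split => /= i ik; last exact: h3.
      by apply: h1; exact: ltnW.
    split => //; have [sn xn] := h1 n (ltnSn n).
    move: sn xn h2; rewrite clocksS /state /waiting (HE _ Hw) => sn xn h2.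
    by split.
  move=> [Hw [wz xt h2]]; split.
  - move=> i; rewrite ltnS leq_eqVlt => /orP[/eqP ->|]; last by move: Hw => [+ _]; exact.
    by rewrite /state /waiting (HE _ Hw).
  - by rewrite clocksS (HE _ Hw).
  - by case: Hw.
move=> a' b' a'0 b'0.
(* The refreshment of the current round comes first, before the ones that are
   still to be used. *)
pose bb i := if i is j.+1 then b j else b'.
have bb0 i : 0 <= bb i by case: i.
have := IH k.+1 a' bb a'0 bb0.
rewrite big_ord_recl/= opprD expRD => IH'.
rewrite (_ : _ * _ * _ = \prod_(i < n) (trans s i * expR (- x i)) * expR (- \sum_y a' y) *
  (expR (- b') * expR (- \sum_(i < k) b i))); last by rewrite /C; ring.
rewrite -IH'; congr (Pr Q _); apply/seteqP; split => w /=.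
  move=> [[h1 h2] [h3 h4]]; split => // -[|i] ik /=; first by rewrite addn0.
  by rewrite -addSnnS; exact: h2.
move=> [h1 h2 h3]; split; split => //.
  by move=> i ik /=; rewrite addSnnS; exact: (h3 i.+1).
by have := h3 0%N isT; rewrite addn0.
Qed.

Lemma path_law n (s : nat -> S) (x : nat -> R) : (forall i, 0 <= x i) ->
  Pr Q [set w | forall i, (i < n)%N -> state i w = s i /\ x i < waiting i w] =
  \prod_(i < n) (trans s i * expR (- x i)).
Proof.
move=> x0; have := @clocks_law n 0 s x (fun=> 0) (fun=> 0) x0 (fun _ => lexx _) (fun _ => lexx _).
have e0 : \sum_(y : S) (0 : R) = 0 by rewrite big1.
rewrite big_ord0 e0 oppr0 expR0 !mulr1 => <-.
congr (Pr Q _); apply/seteqP; split => w /=; last by case.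
by move=> h; split => // y; exact: clocks_gt0.
Qed.

End exploration_law.

(** Serves to sum the probability of a path over one of its states. *)
Definition update (S : Type) (s : nat -> S) (k : nat) (z : S) (i : nat) : S :=
  if i == k then z else s i.

(** The probability that a variable of law Exp(1) exceeds [x], for [x] of
    either sign; rectangles with negative sides are needed to generate the
    sigma-algebra of sequences. *)
Definition exp_tail (R : realType) (x : R) : R := expR (- Num.max x 0).

Section path_marginals.
Context (R : realType) (S : finType) (d : measure_display) (T : measurableType d).
Variables (Q : probability T R) (Z : nat -> T -> S) (X : nat -> T -> R).
Variable tr : (nat -> S) -> nat -> R.
Hypothesis mZ : forall i z, measurable [set w | Z i w = z].
Hypothesis mX : forall i, measurable_fun setT (X i).
Hypothesis tr_local : forall s s' i, (forall j, (j <= i)%N -> s j = s' j) ->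
  tr s i = tr s' i.
Hypothesis tr_sum : forall s i, \sum_z tr (update s i z) i = 1.
Hypothesis path : forall n s x, (forall i, 0 <= x i) ->
  Pr Q [set w | forall i, (i < n)%N -> Z i w = s i /\ x i < X i w] =
  \prod_(i < n) (tr s i * expR (- x i)).

Lemma measurable_fiber_set i (A : set S) : measurable [set w | A (Z i w)].
Proof.
rewrite [X in measurable X](_ : _ = [set w | exists z,
    (if `[< A z >] then [set w | Z i w = z] else set0) w]).
  by apply: measurable_exists_count => z; case: ifP.
apply/seteqP; split => w /=.
  by move=> AZ; exists (Z i w); case: asboolP.
by move=> [z]; case: asboolP => // Az ->.
Qed.

Lemma measurable_path n k (s : nat -> S) (A : nat -> set S) (x : nat -> R) :
  measurable [set w | forall i, (i < n)%N ->
    (if (i < k)%N then Z i w = s i else A i (Z i w)) /\ x i < X i w].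
Proof.
apply: (@measurable_forall_lt _ _ (fun i =>
  [set w | if (i < k)%N then Z i w = s i else A i (Z i w)] `&`
  [set w | x i < X i w])) => i _.
apply: measurableI; first by case: (i < k)%N => //; exact: measurable_fiber_set.
by apply: measurable_lt_set => //; exact: measurable_cst.
Qed.

(** States from [k] on are only constrained to lie in sets. They are summed out
    from the last one backwards, because the factor of a state depends on the
    states before it. A Markov chain is used with the full sets, a sequence of
    independent states with any sets. *)
Lemma path_marginal n k s (A : nat -> set S) (alpha : nat -> R) (x : nat -> R) :
  (k <= n)%N -> (forall i, 0 <= x i) ->
  (forall i s, (k <= i)%N ->
     \sum_(z | z \in A i) tr (update s i z) i = alpha i) ->
  Pr Q [set w | forall i, (i < n)%N ->
    (if (i < k)%N then Z i w = s i else A i (Z i w)) /\ x i < X i w] =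
  \prod_(i < n) ((if (i < k)%N then tr s i else alpha i) * expR (- x i)).
Proof.
move=> kn x0; rewrite -(subKn kn).
elim: (n - k)%N (leq_subr k n) s => [|m IH] mn s Ha.
  rewrite subn0.
  under eq_bigr => i _ do rewrite ltn_ord.
  rewrite -path//; congr (Pr Q _); apply/seteqP; split => w /= H i ni.
    by have := H i ni; rewrite ni.
  by rewrite ni; exact: H.
set k' := (n - m.+1)%N.
have k'n : (k' < n)%N by rewrite /k'; lia.
have ek : (n - m)%N = k'.+1 by rewrite /k'; lia.
pose H := [set w | forall i, (i < n)%N ->
   (if (i < k')%N then Z i w = s i else
      (if i == k' then setT else A i) (Z i w)) /\ x i < X i w].
have mH : measurable H.
  exact: (measurable_path n k' s (fun i => if i == k' then setT else A i) x).
rewrite (_ : [set w | _] = H `&` [set w | A k' (Z k' w)]); last first.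
  apply/seteqP; split => w /=.
    move=> h; split; last by have [] := h k' k'n; rewrite ltnn.
    by move=> i ni; have [h1 h2] := h i ni; split => //; move: h1; case: ifP => // _; case: (i == k').
  move=> [h Aw] i ni; have [h1 h2] := h i ni; split => //; move: h1.
  by case: ifP => // _; case: (eqVneq i k') => [->|].
rewrite (@Pr_fiber _ _ _ Q _ (Z k') H (A k') mH (mZ k')).
under eq_bigr => z _.
  rewrite (_ : _ `&` _ = [set w | forall i, (i < n)%N ->
    (if (i < k'.+1)%N then Z i w = update s k' z i else A i (Z i w)) /\
       x i < X i w]); last first.
    apply/seteqP; split => w /=.
      move=> [h Zk] i ni; have [h1 h2] := h i ni; split => //.
      rewrite /update ltnS leq_eqVlt; move: h1.
      by case: (eqVneq i k') => [->|].
    move=> h; split; last first.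
      by have [] := h k' k'n; rewrite ltnSn /update eqxx.
    move=> i ni; have [h1 h2] := h i ni; split => //; move: h1.
    rewrite /update ltnS leq_eqVlt.
    by case: (eqVneq i k') => [->|] //=; rewrite ltnn.
  rewrite -ek IH; last 2 first.
    exact: ltnW.
    by move=> i s' ki; apply: Ha; rewrite -/k'; lia.
  rewrite ek (bigD1 (Ordinal k'n))//= ltnSn.
  rewrite (eq_bigr (fun i : 'I_n => (if (i < k')%N then tr s i else alpha i) *
     expR (- x i))); last first.
    move=> i; rewrite -val_eqE /= => ik; rewrite ltnS leq_eqVlt (negbTE ik) /=.
    case: ifP => // ik'; congr (_ * _); apply: tr_local => j ji.
    by rewrite /update ifN//; lia.
  over.
rewrite -mulr_suml -mulr_suml Ha// [RHS](bigD1 (Ordinal k'n))//= ltnn.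
by [].
Qed.

Variable z0 : S.

Lemma waiting_pos n : Pr Q [set w | forall i, (i < n)%N -> 0 < X i w] = 1.
Proof.
have := @path_marginal n 0 (fun=> z0) (fun=> setT) (fun=> 1) (fun=> 0) (leq0n n)
  (fun=> lexx _).
rewrite big1 => [H|i _]; last by rewrite ltn0 oppr0 expR0 mulr1.
rewrite -[RHS]H.
  by congr (Pr Q _); apply/seteqP; split => w /= h i ni; [split|have [] := h i ni] => //; exact: h.
move=> i s _; rewrite -(tr_sum s i); apply: eq_bigl => z.
by rewrite in_setT.
Qed.

Lemma path_marginal_tail n k s (A : nat -> set S) (alpha : nat -> R) (x : nat -> R) :
  (k <= n)%N ->
  (forall i s, (k <= i)%N ->
     \sum_(z | z \in A i) tr (update s i z) i = alpha i) ->
  Pr Q [set w | forall i, (i < n)%N ->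
    (if (i < k)%N then Z i w = s i else A i (Z i w)) /\ x i < X i w] =
  \prod_(i < n) ((if (i < k)%N then tr s i else alpha i) * exp_tail (x i)).
Proof.
move=> kn Ha.
rewrite -(@path_marginal n k s A alpha (fun i => Num.max (x i) 0) kn)//; last first.
  by move=> i; rewrite le_max lexx orbT.
have mpos : measurable [set w | forall i, (i < n)%N -> 0 < X i w].
  apply: (@measurable_forall_lt _ _ (fun i => [set w | 0 < X i w])) => i _.
  by apply: measurable_lt_set => //; exact: measurable_cst.
rewrite -(PrI_full (measurable_path n k s A x) mpos (waiting_pos n)).
congr (Pr Q _); apply/seteqP; split => w /=.
  move=> [h h0] i ni; have [h1 h2] := h i ni; split => //.
  by rewrite gt_max h2 h0.
move=> h; split => i ni; have [h1] := h i ni; rewrite gt_max => /andP[h2 h3] //.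
Qed.

End path_marginals.

(** * Partial sums of exponential gaps and the Poisson law *)

Section sequences.
Variable R : realType.

(** Rectangles that constrain the first [n] terms. They are closed under
    intersection for a fixed [n], and every event below depends on finitely
    many terms. *)
Definition rect n : set (set (nat -> R)) :=
  [set A | exists x : nat -> R, A = [set f | forall i, (i < n)%N -> x i < f i]].

Lemma rectI n : setI_closed (rect n).
Proof.
move=> _ _ [x ->] [y ->]; exists (fun i => Num.max (x i) (y i)).
apply/seteqP; split => f /=.
  by move=> [h1 h2] i ni; rewrite gt_max h1// h2.
by move=> h; split => i ni; have := h i ni; rewrite gt_max => /andP[].
Qed.

Lemma seq_product_rule d1 (T1 : measurableType d1) (Q1 : probability T1 R)
    d2 (T2 : measurableType d2) (Q2 : probability T2 R)
    (X : nat -> T1 -> R) (Y : nat -> T2 -> R) (H : set T1) n :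
  (forall i, measurable_fun setT (X i)) -> (forall i, measurable_fun setT (Y i)) ->
  measurable H ->
  (forall x, Pr Q1 (H `&` [set w | forall i, (i < n)%N -> x i < X i w]) =
     Pr Q1 H * Pr Q2 [set w | forall i, (i < n)%N -> x i < Y i w]) ->
  forall A, <<s rect n >> A ->
    Pr Q1 (H `&` [set w | A (X ^~ w)]) = Pr Q1 H * Pr Q2 [set w | A (Y ^~ w)].
Proof.
move=> mX mY mH XY.
have mrect d (T : measurableType d) (X' : nat -> T -> R) (x : nat -> R) :
    (forall i, measurable_fun setT (X' i)) ->
    measurable [set w | forall i, (i < n)%N -> x i < X' i w].
  move=> mX'; apply: (@measurable_forall_lt _ _ (fun i => [set w | x i < X' i w])).
  by move=> i _; apply: measurable_lt_set => //; exact: measurable_cst.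
apply: (@product_rule_sigma R _ _ Q1 _ _ Q2 (nat -> R) (fun w => X ^~ w)
   (fun w => Y ^~ w) (rect n)) => //.
- exact: rectI.
- by move=> _ [x ->]; exact: mrect.
- by move=> _ [x ->]; exact: mrect.
- by move=> _ [x ->]; exact: XY.
Qed.

(** A ray in one coordinate is the union over [k] of the rectangles whose other
    sides start at [- k]. *)
Lemma measurable_coord n i : (i < n)%N ->
  measurable_fun [set: g_sigma_algebraType (rect n)]
    (fun f : g_sigma_algebraType (rect n) => (f : nat -> R) i).
Proof.
move=> ni; apply: (measurability _ (RGenOInfty.measurableE R)) => //.
move=> _ [_ [x ->] <-]; rewrite setTI [X in measurable X](_ : _ =
  \bigcup_k [set f : nat -> R | forall j, (j < n)%N ->
     (if j == i then x else - k%:R) < f j]).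
  apply: bigcupT_measurable => k; apply: sub_sigma_algebra.
  by exists (fun j => if j == i then x else - k%:R).
apply/seteqP; split => f /=; rewrite in_itv/= andbT.
  (* M bounds the absolute values of all n coordinates. *)
  move=> xf; pose M := \sum_(j < n) `|f j|.
  exists (Num.truncn M).+1 => //= j jn; case: eqP => [-> //|_].
  rewrite ltrNl; apply: le_lt_trans (truncnS_gt M).
  rewrite /M (bigD1 (Ordinal jn))//=.
  apply: (@le_trans _ _ `|f j|); first by rewrite -normrN ler_norm.
  by rewrite lerDl sumr_ge0.
by move=> [k _ /(_ i ni)]; rewrite eqxx.
Qed.

Lemma seq_sigma_sum_le n m (a : R) : (m <= n)%N ->
  <<s rect n >> [set f : nat -> R | \sum_(i < m) f i <= a].
Proof.
move=> mn.
suff : measurable [set f : g_sigma_algebraType (rect n) |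
   \sum_(i < m) (f : nat -> R) i <= a] by [].
apply: measurable_le_set; last exact: measurable_cst.
apply: measurable_sum => i; apply: measurable_coord.
exact: leq_trans mn.
Qed.

End sequences.

Section exp_poly.
Variable R : realType.
Implicit Types (s t : R) (n k : nat).

(** The Taylor polynomial of the exponential with [n] terms, so that [expR (-
    t) * exp_poly n t] is the probability that a Poisson variable of parameter
    [t] is less than [n]. *)
Definition exp_poly n t : R := \sum_(k < n) t ^+ k / k`!%:R.

Lemma exp_poly_ge0 n t : 0 <= t -> 0 <= exp_poly n t.
Proof. by move=> t0; apply: sumr_ge0 => k _; rewrite divr_ge0// exprn_ge0. Qed.

Lemma le_exp_poly n s t : 0 <= s -> s <= t -> exp_poly n s <= exp_poly n t.
Proof.
move=> s0 st; apply: ler_sum => k _; rewrite ler_wpM2r ?invr_ge0//.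
by rewrite lerXn2r ?nnegrE// (le_trans s0).
Qed.

Lemma exprn_increment k s t : 0 <= s -> s <= t ->
  (t - s) * (k.+1%:R * s ^+ k) <= t ^+ k.+1 - s ^+ k.+1 <=
  (t - s) * (k.+1%:R * t ^+ k).
Proof.
move=> s0 st; have t0 : 0 <= t by exact: le_trans st.
have d0 : 0 <= t - s by rewrite subr_ge0.
elim: k => [|k /andP[IH1 IH2]]; first by rewrite !expr0 !expr1 !mulr1 lexx.
have e : t ^+ k.+2 - s ^+ k.+2 = t * (t ^+ k.+1 - s ^+ k.+1) + (t - s) * s ^+ k.+1.
  by rewrite (exprS t k.+1) (exprS s k.+1); ring.
have e' : t ^+ k.+2 - s ^+ k.+2 = s * (t ^+ k.+1 - s ^+ k.+1) + (t - s) * t ^+ k.+1.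
  by rewrite (exprS t k.+1) (exprS s k.+1); ring.
have stk : s ^+ k.+1 <= t ^+ k.+1 by rewrite lerXn2r ?nnegrE.
apply/andP; split.
  rewrite e' (_ : _ * _ = s * ((t - s) * (k.+1%:R * s ^+ k)) + (t - s) * s ^+ k.+1).
    by rewrite lerD// ler_wpM2l.
  by rewrite -natr1 (exprS s k); ring.
rewrite e (_ : _ * (_ * _) = t * ((t - s) * (k.+1%:R * t ^+ k)) + (t - s) * t ^+ k.+1).
  by rewrite lerD// ler_wpM2l.
by rewrite -natr1 (exprS t k); ring.
Qed.

(** [exp_poly n] is the derivative of [exp_poly n.+1], and it is monotone. *)
Lemma exp_poly_increment n s t : 0 <= s -> s <= t ->
  (t - s) * exp_poly n s <= exp_poly n.+1 t - exp_poly n.+1 s <=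
  (t - s) * exp_poly n t.
Proof.
move=> s0 st.
have -> : exp_poly n.+1 t - exp_poly n.+1 s =
    \sum_(i < n) (t ^+ i.+1 - s ^+ i.+1) / i.+1`!%:R.
  rewrite /exp_poly !big_ord_recl !expr0 opprD addrACA subrr add0r -sumrB.
  by apply: eq_bigr => i _; rewrite mulrBl.
rewrite /exp_poly !mulr_sumr.
have fk i (u : R) : (t - s) * (u ^+ i / i`!%:R) = (t - s) * (i.+1%:R * u ^+ i) / i.+1`!%:R.
  rewrite factS natrM invfM; field.
  by rewrite addrC natr1 !pnatr_eq0 -lt0n fact_gt0.
by apply/andP; split; apply: ler_sum => i _; rewrite fk ler_wpM2r ?invr_ge0//;
  case/andP: (exprn_increment i s0 st).
Qed.

Lemma exp_poly_lipschitz n s t : 0 <= s -> s <= t ->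
  exp_poly n t - exp_poly n s <= (t - s) * exp_poly n t.
Proof.
move=> s0 st; have t0 : 0 <= t by exact: le_trans st.
have d0 : 0 <= t - s by rewrite subr_ge0.
case: n => [|n]; first by rewrite /exp_poly !big_ord0 subrr mulr0.
have /andP[_ h] := exp_poly_increment n s0 st; apply: le_trans h _.
rewrite ler_wpM2l// /exp_poly [leRHS]big_ord_recr/= lerDl.
by rewrite divr_ge0// exprn_ge0.
Qed.

End exp_poly.

Section partial_sums.
Context (R : realType) (d : measure_display) (T : measurableType d).
Variables (Q : probability T R) (X : nat -> T -> R).
Hypothesis mX : forall i, measurable_fun setT (X i).
Hypothesis X0 : forall i w, 0 <= X i w.
Hypothesis lawX : forall n (x : nat -> R),
  Pr Q [set w | forall i, (i < n)%N -> x i < X i w] = \prod_(i < n) exp_tail (x i).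

Definition arrival n w : R := \sum_(i < n) X i w.

Lemma measurable_arrival n : measurable_fun setT (arrival n).
Proof. by apply: measurable_sum => i; exact: mX. Qed.

Lemma arrival_ge0 n w : 0 <= arrival n w.
Proof. by apply: sumr_ge0 => i _; exact: X0. Qed.

Lemma arrival_le n m w : (n <= m)%N -> arrival n w <= arrival m w.
Proof.
move=> nm; rewrite -(subnKC nm); elim: (m - n)%N => [|k IH]; first by rewrite addn0.
by rewrite addnS /arrival big_ord_recr/=; apply: (le_trans IH); rewrite lerDl.
Qed.

Let mgt (f : T -> R) (a : R) : measurable_fun setT f -> measurable [set w | a < f w].
Proof. by move=> mf; apply: measurable_lt_set => //; exact: measurable_cst. Qed.

Lemma exp_tail_ge0E (x : R) : 0 <= x -> exp_tail x = expR (- x).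
Proof. by move=> x0; rewrite /exp_tail max_l. Qed.

(** The law of the gaps is a product on rectangles, and those of length [n]
    generate the events on the sum of the first [n] gaps. *)
Lemma Pr_gap_arrival n (t u : R) :
  Pr Q ([set w | t < X n w] `&` [set w | u < arrival n w]) =
  exp_tail t * Pr Q [set w | u < arrival n w].
Proof.
have Ht : Pr Q [set w | t < X n w] = exp_tail t.
  have := lawX n.+1 (fun i => if i == n then t else -1).
  rewrite big_ord_recr/= eqxx big1 ?mul1r => [<-|i _]; last first.
    by rewrite ltn_eqF// /exp_tail max_r ?oppr0 ?expR0// lerN10.
  congr (Pr Q _); apply/seteqP; split => w /=.
    by move=> tX i _; case: eqP => [-> //|_]; exact: lt_le_trans (X0 i w).
  by move=> /(_ n (ltnSn n)); rewrite eqxx.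
rewrite -Ht.
have := @seq_product_rule R _ _ Q _ _ Q X X [set w | t < X n w] n mX mX (mgt _ (mX n)).
have -> : [set w | u < arrival n w] = [set w | (~` [set f : nat -> R | \sum_(i < n) f i <= u]) (X ^~ w)].
  by apply/seteqP; split => w /=; rewrite ltNge => /negP.
apply.
  move=> x; rewrite Ht lawX.
  have := lawX n.+1 (fun i => if i == n then t else x i).
  rewrite big_ord_recr/= eqxx mulrC => E.
  rewrite [X in _ = _ * X](eq_bigr (fun i : 'I_n => exp_tail (if i == n :> nat then t else x i))).
    rewrite -E; congr (Pr Q _); apply/seteqP; split => w /=.
      move=> [tX h] i; rewrite ltnS leq_eqVlt => /orP[/eqP ->|ni]; first by rewrite eqxx.
      by rewrite ltn_eqF// h.
    move=> h; split; first by have := h n (ltnSn n); rewrite eqxx.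
    by move=> i ni; have := h i (ltnW ni); rewrite ltn_eqF.
  by move=> i _; rewrite ltn_eqF.
have [_ SC _] := smallest_sigma_algebra setT (@rect R n).
by rewrite -setTD; apply: SC; exact: seq_sigma_sum_le.
Qed.

Lemma Pr_gap_pos n : Pr Q [set w | 0 < X n w] = 1.
Proof.
have := Pr_gap_arrival n 0 (-1); rewrite exp_tail_ge0E// oppr0 expR0 mul1r.
rewrite (_ : [set w | -1 < arrival n w] = setT).
  by rewrite setIT Pr_setT.
apply/seteqP; split => w //= _; apply: lt_le_trans (arrival_ge0 n w).
exact: ltrN10.
Qed.

(** The gamma tail. The probability that the sum exceeds [lam] while its last
    term exceeds [x] has derivative [- expR (- lam) * exp_poly n (lam - x)] in
    [x], as the exponentials of [x] cancel. *)
Lemma arrival_tail n (lam : R) : 0 <= lam ->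
  Pr Q [set w | lam < arrival n w] = expR (- lam) * exp_poly n lam.
Proof.
elim: n lam => [|n IH] lam lam0.
  rewrite /exp_poly big_ord0 mulr0 (_ : [set w | _] = set0) ?Pr_set0//.
  by rewrite -subset0 => w /=; rewrite /arrival big_ord0 ltNge lam0.
pose BX := [set w | lam - X n w < arrival n w].
have mBX : measurable BX.
  apply: measurable_lt_set; last exact: measurable_arrival.
  by apply: measurable_funB => //; exact: measurable_cst.
have mB u : measurable [set w | u < arrival n w] by exact/mgt/measurable_arrival.
have mXgt u : measurable [set w | u < X n w] by exact/mgt.
pose f x := Pr Q ([set w | x < X n w] `&` BX).
(* The value that f x should have; the two agree at x = lam, and their equality
   at x = 0 is the claim. *)
pose F x := expR (- lam) * exp_poly n.+1 (lam - x).
have f0E : f 0 = Pr Q [set w | lam < arrival n.+1 w].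
  rewrite /f setIC PrI_full ?Pr_gap_pos//; congr (Pr Q _).
  by apply/seteqP; split => w; rewrite /BX /= /arrival big_ord_recr/= ltrBlDr.
rewrite -f0E.
have -> : expR (- lam) * exp_poly n.+1 lam = F 0 by rewrite /F subr0.
have flF : f lam = F lam.
  rewrite /F subrr /exp_poly big_ord_recl big1 => [|i _]; last by rewrite expr0n mul0r.
  rewrite expr0 divr1 addr0 mulr1 /f.
  rewrite (_ : _ `&` _ = [set w | lam < X n w] `&` [set w | -1 < arrival n w]).
    rewrite Pr_gap_arrival exp_tail_ge0E// (_ : [set w | -1 < arrival n w] = setT) ?Pr_setT ?mulr1//.
    by apply/seteqP; split => w //= _; apply: lt_le_trans (arrival_ge0 n w).
  apply/seteqP; split => w /= [lX _]; split => //.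
    by apply: lt_le_trans (arrival_ge0 n w).
  by rewrite /BX /=; apply: lt_le_trans (arrival_ge0 n w); rewrite subr_lt0.
pose a0 := expR (- lam) * exp_poly n lam.
have a00 : 0 <= a0 by rewrite mulr_ge0 ?expR_ge0 ?exp_poly_ge0.
suff : f 0 - F 0 = f lam - F lam by rewrite flF subrr => /eqP; rewrite subr_eq0 => /eqP.
apply: (@eq_quadratic_increments _ (fun x => f x - F x) _ _ (a0 * (1 + expR lam))) => // x y x0 xy yl.
set h := y - x; have h0 : 0 <= h by rewrite subr_ge0.
set t := lam - x; have t0 : 0 <= t by rewrite subr_ge0 (le_trans xy).
have th : lam - y = t - h by rewrite /t /h; ring.
have th0 : 0 <= t - h by rewrite -th subr_ge0.
have tht : t - h <= t by rewrite gerBl.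
have y0 := le_trans x0 xy.
have hl : h <= lam by rewrite /h; lra.
pose al := expR (- lam) * exp_poly n t.
have al0 : 0 <= al by rewrite mulr_ge0 ?expR_ge0 ?exp_poly_ge0.
have ala : al <= a0.
  by rewrite ler_wpM2l ?expR_ge0// le_exp_poly// /t lerBlDr lerDl.
have slice u : u <= lam ->
    Pr Q ([set w | x < X n w <= y] `&` [set w | lam - u < arrival n w]) =
    (expR (- x) - expR (- y)) * (expR (- (lam - u)) * exp_poly n (lam - u)).
  move=> ul; rewrite -Pr_slice// !Pr_gap_arrival !exp_tail_ge0E// IH ?subr_ge0//; ring.
have mxy : measurable [set w | x < X n w <= y].
  rewrite [X in measurable X](_ : _ = [set w | x < X n w] `\` [set w | y < X n w]).
    exact: measurableD.
  apply/seteqP; split => w /=.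
    by move=> /andP[-> Xy]; split => //; apply/negP; rewrite -leNgt.
  by move=> [-> /negP]; rewrite -leNgt.
have fE : f x - f y = Pr Q ([set w | x < X n w <= y] `&` BX) by rewrite /f Pr_slice.
have flo : al * (h - h ^+ 2) <= f x - f y.
  apply: (@le_trans _ _ (al * (1 - expR (- h)))).
    by rewrite ler_wpM2l// sub1_expRN_ge.
  rewrite fE (_ : al * _ = Pr Q ([set w | x < X n w <= y] `&` [set w | lam - x < arrival n w])).
    apply: le_Pr; try exact: measurableI.
    move=> w /= [/andP[xX Xy] H]; split; first by rewrite xX.
    by apply: le_lt_trans H; rewrite lerB// ltW.
  rewrite slice ?(le_trans xy)// -/t /al.
  have -> : expR (- y) = expR (- x) * expR (- h).
    by rewrite -expRD; congr expR; rewrite /h; ring.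
  have -> : expR (- lam) = expR (- x) * expR (- t).
    by rewrite -expRD; congr expR; rewrite /t; ring.
  ring.
have fup : f x - f y <= al * (h + h ^+ 2 * expR lam).
  apply: (@le_trans _ _ (al * (expR h - 1))); last first.
    rewrite ler_wpM2l//.
    have e1 : expR h - 1 <= h * expR h.
      have -> : expR h - 1 = (1 - expR (- h)) * expR h.
        by rewrite mulrBl mul1r -expRD addNr expR0.
      by rewrite ler_wpM2r ?expR_ge0// sub1_expRN_le.
    have e2 : expR h <= expR lam by rewrite ler_expR.
    have : h * (expR h - 1) <= h * (h * expR lam).
      rewrite ler_wpM2l//; apply: le_trans e1 _; exact: ler_wpM2l.
    by rewrite expr2; lra.
  rewrite fE; apply: (@le_trans _ _ (Pr Q ([set w | x < X n w <= y] `&` [set w | lam - y < arrival n w]))).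
    apply: le_Pr; try exact: measurableI.
    move=> w /= [/andP[xX Xy] H]; split; first by rewrite xX.
    by apply: le_lt_trans H; rewrite lerB.
  rewrite slice// th.
  have -> : (expR (- x) - expR (- y)) * (expR (- (t - h)) * exp_poly n (t - h)) =
      expR (- lam) * (expR h - 1) * exp_poly n (t - h).
    have -> : expR (- y) = expR (- x) * expR (- h).
      by rewrite -expRD; congr expR; rewrite /h; ring.
    have -> : expR (- lam) = expR (- x) * expR (- t).
      by rewrite -expRD; congr expR; rewrite /t; ring.
    have -> : expR (- (t - h)) = expR (- t) * expR h.
      by rewrite -expRD; congr expR; ring.
    have hh : expR (- h) * expR h = 1 by rewrite -expRD addNr expR0.
    rewrite -[in RHS]hh; ring.
  rewrite /al [leRHS]mulrAC ler_wpM2l ?le_exp_poly//.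
  by rewrite mulr_ge0 ?expR_ge0// subr_ge0 -expR0 ler_expR.
have FE : F x - F y = expR (- lam) * (exp_poly n.+1 t - exp_poly n.+1 (t - h)).
  by rewrite /F th -/t mulrBr.
have /andP[] := exp_poly_increment n th0 tht; rewrite subKr => q1 q2.
have q3 := exp_poly_lipschitz n th0 tht; rewrite subKr in q3.
have Fup : F x - F y <= al * h.
  by rewrite FE /al -mulrA ler_wpM2l ?expR_ge0// mulrC.
have Flo : al * (h - h ^+ 2) <= F x - F y.
  rewrite FE /al -mulrA ler_wpM2l ?expR_ge0//; apply: le_trans q1.
  have : h * (exp_poly n t - exp_poly n (t - h)) <= h * (h * exp_poly n t).
    exact: ler_wpM2l.
  by rewrite expr2; lra.
(* al depends on the point x; a0 is its maximum over x, reached at x = 0. *)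
have K1 : al * h ^+ 2 <= a0 * h ^+ 2 by rewrite ler_wpM2r ?exprn_ge0.
have K2 : al * (h ^+ 2 * expR lam) <= a0 * (h ^+ 2 * expR lam).
  by rewrite ler_wpM2r// mulr_ge0 ?exprn_ge0 ?expR_ge0.
have K3 : 0 <= a0 * (h ^+ 2 * expR lam).
  by rewrite mulr_ge0// mulr_ge0 ?exprn_ge0 ?expR_ge0.
have -> : a0 * (1 + expR lam) * h ^+ 2 = a0 * h ^+ 2 + a0 * (h ^+ 2 * expR lam).
  by ring.
rewrite mulrDr in fup; rewrite mulrBr in flo; rewrite mulrBr in Flo.
by rewrite ler_norml; apply/andP; split; lra.
Qed.

End partial_sums.

Section first_passage.
Variable R : realType.
Implicit Types (lam : R) (a : nat -> R).

(** The number of arrival times [a 1, a 2, ...] that are at most [lam], when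
    the sequence [a] is nondecreasing and passes [lam]. *)
Definition first_passage lam a : nat :=
  if pselect (exists n, lam < a n.+1) is left h then ex_minn h else 0%N.

Lemma first_passage_lt lam a :
  (exists n, lam < a n.+1) -> lam < a (first_passage lam a).+1.
Proof.
by move=> h; rewrite /first_passage; case: pselect => // h'; case: ex_minnP.
Qed.

Lemma first_passage_le lam a j : (j < first_passage lam a)%N -> a j.+1 <= lam.
Proof.
rewrite /first_passage; case: pselect => // h; case: ex_minnP => m _ hm jm.
by rewrite leNgt; apply/negP => /hm; rewrite leqNgt jm.
Qed.

Lemma first_passage_eq lam a k : (forall n m, (n <= m)%N -> a n <= a m) ->
  a k <= lam -> lam < a k.+1 -> first_passage lam a = k.
Proof.
move=> nd ak ak1; apply/eqP; rewrite eqn_leq; apply/andP; split; rewrite leqNgt.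
  by apply/negP => /first_passage_le; rewrite leNgt ak1.
apply/negP => fk; have /first_passage_lt : exists n, lam < a n.+1 by exists k.
by rewrite ltNge (le_trans _ ak)// nd.
Qed.

Lemma measurable_first_passage lam d (T : measurableType d) (f : nat -> T -> R) :
  (forall n, measurable_fun setT (f n)) ->
  measurable_fun setT (fun w => first_passage lam (f ^~ w)).
Proof.
move=> mf; apply: measurable_nat_fun => n.
rewrite [X in measurable X](_ : _ = [set w | exists m, lam < f m.+1 w] `&`
   [set w | forall j, (j < n.+1)%N -> f j.+1 w <= lam]).
  apply: measurableI.
    apply: (@measurable_exists_count _ _ _ (fun m => [set w | lam < f m.+1 w])) => m.
    by apply: measurable_lt_set => //; exact: measurable_cst.
  apply: (@measurable_forall_lt _ _ (fun j => [set w | f j.+1 w <= lam])) => j _.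
  by apply: measurable_le_set => //; exact: measurable_cst.
apply/seteqP; split => w /=.
  move=> nf; split; last by move=> j jn; exact: (@first_passage_le lam (f ^~ w) j (leq_trans jn nf)).
  by move: nf; rewrite /first_passage; case: pselect.
move=> [h hn]; rewrite ltnNge; apply/negP => fn.
by have := @first_passage_lt lam (f ^~ w) h; rewrite ltNge hn.
Qed.

End first_passage.

Section poisson.
Context (R : realType) (d : measure_display) (T : measurableType d).
Variables (Q : probability T R) (X : nat -> T -> R).
Hypothesis mX : forall i, measurable_fun setT (X i).
Hypothesis X0 : forall i w, 0 <= X i w.
Hypothesis lawX : forall n (x : nat -> R),
  Pr Q [set w | forall i, (i < n)%N -> x i < X i w] = \prod_(i < n) exp_tail (x i).
Variable lam : R.
Hypothesis lam0 : 0 < lam.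

Local Notation arrival := (arrival X).
Definition arrival_count w : nat := first_passage lam (fun n => arrival n w).

Let mgt n (a : R) : measurable [set w | a < arrival n w].
Proof.
by apply: measurable_lt_set => //; exact: measurable_arrival.
Qed.

Lemma measurable_arrival_count : measurable_fun setT arrival_count.
Proof.
by apply: (measurable_first_passage lam (f := arrival)) => n; exact: measurable_arrival.
Qed.

Definition passes : set T := [set w | exists n, lam < arrival n.+1 w].

Lemma measurable_passes : measurable passes.
Proof.
exact: (@measurable_exists_count _ _ _ (fun m => [set w | lam < arrival m.+1 w])).
Qed.

(** The partial sums exceed [lam] eventually, because the tails [expR (- lam) *
    exp_poly n lam] increase to 1. *)
Lemma Pr_passes : Pr Q passes = 1.
Proof.
apply/eqP; rewrite eq_le (Pr_le1 Q measurable_passes)/=.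
have h n : expR (- lam) * exp_poly n.+1 lam <= Pr Q passes.
  rewrite -(arrival_tail mX X0 lawX _ (ltW lam0)).
  apply: le_Pr => //; first exact: measurable_passes.
  by move=> w /= h; exists n.
have cv : (fun n => expR (- lam) * exp_poly n.+1 lam) @ \oo --> expR (- lam) * expR lam.
  apply: cvgM; first exact: cvg_cst.
  have : series (exp_coeff lam) @ \oo --> expR lam by exact: is_cvg_series_exp_coeff.
  rewrite -(cvg_shiftS (series (exp_coeff lam))).
  rewrite (_ : (fun n => series (exp_coeff lam) n.+1) = fun n => exp_poly n.+1 lam)//.
  by apply/funext => n; rewrite /series/= big_mkord.
rewrite -expRD addNr expR0 in cv.
rewrite -(cvg_lim _ cv)//; apply: limr_le; first by apply/cvg_ex; exists 1.
by apply: nearW => n.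
Qed.

(** There are [k] arrivals up to [lam] when the [k.+1]-st one is after [lam]
    and the [k]-th one is not, so the probability is a difference of two gamma
    tails. *)
Lemma arrival_count_eq k :
  [set w | arrival_count w = k] `&` passes =
  [set w | lam < arrival k.+1 w] `\` [set w | lam < arrival k w].
Proof.
apply/seteqP; split => w /=.
  move=> [<- h]; split; first exact: (@first_passage_lt R lam (fun n => arrival n w) h).
  apply/negP; rewrite -leNgt.
  case E : (arrival_count w) => [|j]; first by rewrite /arrival big_ord0 ltW.
  apply: (@first_passage_le R lam (fun n => arrival n w) j).
  by rewrite -/(arrival_count w) E.
move=> [h1 /negP]; rewrite -leNgt => h2; split; last by exists k.
apply: (@first_passage_eq R lam (fun n => arrival n w)) => //.
by move=> n m; exact: arrival_le.
Qed.

Lemma arrival_count_pmf k :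
  Pr Q [set w | arrival_count w = k] = expR (- lam) * (lam ^+ k / k`!%:R).
Proof.
have mk : measurable [set w | arrival_count w = k].
  exact: measurable_nat_fiber1 measurable_arrival_count.
rewrite -(PrI_full mk measurable_passes Pr_passes) arrival_count_eq.
have := PrDI Q (mgt k.+1 lam) (mgt k lam).
rewrite (_ : _ `&` _ = [set w | lam < arrival k w]).
  rewrite !(arrival_tail mX X0 lawX _ (ltW lam0)) /exp_poly big_ord_recr/= mulrDr => /eqP.
  by rewrite addrC [X in _ == X]addrC (inj_eq (addIr _)) => /eqP <-.
apply/seteqP; split => w /=; first by case.
by move=> h; split => //; apply: lt_le_trans h _; exact: arrival_le.
Qed.

Lemma arrival_count_law (A : set nat) :
  Q [set w | A (arrival_count w)] = poisson_prob lam 0 A.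
Proof.
rewrite /poisson_prob lam0.
rewrite (_ : [set w | _] = \bigcup_(k in A) [set w | arrival_count w = k]); last first.
  apply/seteqP; split => w /=; first by exists (arrival_count w).
  by move=> [k Ak ->].
have mk k : measurable [set w | arrival_count w = k].
  exact: measurable_nat_fiber1 measurable_arrival_count.
rewrite measure_bigcup//; last first.
  by move=> i j _ _ [w [/= <- <-]].
rewrite nneseries_esum ?set_mem_set//.
apply: eq_esum => k _.
by rewrite [LHS](PrE Q (mk k)) arrival_count_pmf /poisson_pmf lam0; congr EFin; ring.
Qed.

End poisson.

(** * Soft local times *)

Section pathwise.
Variables (R : realType) (S : finType) (z0 : S).
Variables (pi0 : S -> R) (p : S -> S -> R).
Hypotheses (hp : stochastic p) (hpi0 : prob_vector pi0).
Variable T : Type.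
Variables (E : S -> T -> R) (F : nat -> T -> R).
Hypotheses (E0 : forall y w, 0 < E y w) (F0 : forall n w, 0 < F n w).

Local Notation rate := (rate pi0 p).
Local Notation clocks := (clocks z0 pi0 p E F).
Local Notation state := (state z0 pi0 p E F).
Local Notation waiting := (waiting z0 pi0 p E F).

(** The soft local time: the total distance run by the clock of [y] in the
    first [n] rounds, including after it has been set anew. *)
Definition local_time n w y : R :=
  \sum_(i < n) waiting i w * rate (previous (state ^~ w) i) y.

Lemma local_timeS n w y : local_time n.+1 w y =
  local_time n w y + waiting n w * rate (previous (state ^~ w) n) y.
Proof. by rewrite /local_time big_ord_recr. Qed.

Lemma le_local_time n m w y : (n <= m)%N -> local_time n w y <= local_time m w y.
Proof.
move=> nm; rewrite -(subnKC nm); elim: (m - n)%N => [|k IH]; first by rewrite addn0.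
rewrite addnS local_timeS (le_trans IH)// lerDl mulr_ge0//.
  by apply: wait_time_ge0; exact: clocks_gt0.
case: previous => [z|]; first by have [h _] := hp z; exact: h.
by have [h _] := hpi0; exact: h.
Qed.

(** Until [y] wins for the first time its clock is never set anew. *)
Lemma unvisited n w y : (forall i, (i < n)%N -> state i w != y) ->
  (clocks n w).1 y = E y w - local_time n w y.
Proof.
elim: n => [|n IH] h; first by rewrite /local_time big_ord0 subr0.
rewrite clocksS local_timeS /= /residual.
rewrite -[winner _ _ _]/(state n w) eq_sym (negbTE (h n (ltnSn n))).
rewrite IH; last by move=> i ni; apply: h; exact: ltnW.
by rewrite -(clocks2 z0 pi0 p E F) opprD addrA.
Qed.

Lemma visited_at n w : 0 < waiting n w ->
  (clocks n w).1 (state n w) =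
    waiting n w * rate (previous (state ^~ w) n) (state n w).
Proof.
move=> h; have ww := wait_time_wins h.
rewrite /waiting /wait_time ww -/(state n w) clocks2 divfK//.
by rewrite gt_eqF//; case/andP: ww; rewrite -/(state n w) clocks2.
Qed.

(** At its first victory the clock of a state has run down exactly to 0, so its
    initial value was the local time then; local times only grow. *)
Lemma visited_le t w i : (i < t)%N -> (forall j, (j < t)%N -> 0 < waiting j w) ->
  E (state i w) w <= local_time t w (state i w).
Proof.
move=> it pos; set y := state i w.
have ex : exists j, state j w == y by exists i; exact: eqxx.
have ji : (ex_minn ex <= i)%N by case: ex_minnP => m _; apply; exact: eqxx.
move: ji; case: ex_minnP => j /eqP jy hj ji.
have jt : (j < t)%N by exact: leq_ltn_trans it.
have un : forall k, (k < j)%N -> state k w != y.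
  by move=> k kj; apply/negP => /hj; rewrite leqNgt kj.
have := visited_at (pos j jt); rewrite jy (unvisited un) => /eqP.
rewrite subr_eq addrC -local_timeS => /eqP ->.
exact: le_local_time.
Qed.

(** Identifies the soft local time of the chain with the sum that the theorem
    compares to [lambda * pist]. *)
Lemma local_time_markov t w y : local_time t.+1 w y =
  waiting 0 w * pi0 y + \sum_(1 <= j < t.+1) waiting j w * p (state j.-1 w) y.
Proof.
rewrite /local_time big_ord_recl /=; congr (_ + _).
by rewrite big_add1 /= big_mkord; apply: eq_bigr => i _.
Qed.

End pathwise.

Section pathwise_iid.
Variables (R : realType) (S : finType) (z0 : S) (mu : S -> R).
Hypothesis hmu : prob_vector mu.
Variable T : Type.
Variables (E : S -> T -> R) (F : nat -> T -> R).
Hypotheses (E0 : forall y w, 0 < E y w) (F0 : forall n w, 0 < F n w).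
Local Notation state := (state z0 mu (fun=> mu) E F).
Local Notation waiting := (waiting z0 mu (fun=> mu) E F).
Local Notation clocks := (clocks z0 mu (fun=> mu) E F).

Lemma rate_iid (o : option S) : rate mu (fun=> mu) o = mu.
Proof. by case: o. Qed.

Lemma local_time_iid n w y :
  local_time z0 mu (fun=> mu) E F n w y = (\sum_(i < n) waiting i w) * mu y.
Proof.
by rewrite /local_time mulr_suml; apply: eq_bigr => i _; rewrite rate_iid.
Qed.

(** With constant speeds [mu] the local time of [y] is [mu y] times the elapsed
    time. If [y] had not won among the arrivals up to [lam], its clock would
    still be running, or would just ring, at the first arrival after [lam], and
    would then have held more than [lam * mu y]. *)
Lemma reached lam w y : 0 < lam ->
  (exists n, lam < \sum_(i < n.+1) waiting i w) -> E y w <= lam * mu y ->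
  exists2 k, (k < first_passage lam (fun n => (\sum_(i < n) waiting i w)%R))%N &
             state k w = y.
Proof.
move=> lam0 ex Ey; set a := fun n => \sum_(i < n) waiting i w; set N := first_passage lam a.
have aS n : a n.+1 = a n + waiting n w by rewrite /a big_ord_recr.
have aN : lam < a N.+1 by exact: first_passage_lt.
have [mu0 _] := hmu.
apply: contrapT => H.
have un k : (k < N)%N -> state k w != y.
  by move=> kN; apply/negP => /eqP ky; apply: H; exists k.
have cpos n : 0 < (clocks n w).1 y by exact: clocks_gt0.
(* Round N is the first one that ends after lam; y may win it or not. *)
have [Ny|Ny] := eqVneq (state N w) y; last first.
  have : 0 < (clocks N.+1 w).1 y by [].
  rewrite (@unvisited _ _ _ _ _ _ _ _ N.+1); last first.
    by move=> i; rewrite ltnS leq_eqVlt => /orP[/eqP -> //|]; exact: un.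
  rewrite local_time_iid subr_gt0 ltNge => /negP; apply.
  by apply: (le_trans Ey); rewrite ler_wpM2r// ltW.
have rN0 : 0 <= waiting N w by apply: wait_time_ge0; exact: clocks_gt0.
have [rN|rN] := ltP 0 (waiting N w); last first.
  have : lam < a N by have := aN; rewrite aS; lra.
  case EN : N => [|j]; first by rewrite /a big_ord0 ltNge ltW.
  by rewrite ltNge (@first_passage_le _ lam a j)// -/N EN.
have ww := wait_time_wins rN; rewrite -/(state N w) Ny rate_iid in ww.
have muy : 0 < mu y by case/andP: ww.
have := visited_at rN; rewrite Ny unvisited// local_time_iid rate_iid => /eqP.
rewrite subr_eq -mulrDl addrC -[_ + _]aS => /eqP Ey'.
by move: Ey; rewrite Ey' ler_pM2r// leNgt aN.
Qed.

End pathwise_iid.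

(** * Independence of the marks and of their number *)

(** Mutual independence need only be checked on initial segments: a finite set
    of indices is completed with the sure event. *)
Lemma mutually_independent_initial (R : realType) d (T : measurableType d)
    (Q : probability T R) (F : nat -> set (set T)) :
  (forall i, F i setT) ->
  (forall n (A : nat -> set T), (forall i, F i (A i)) ->
    Q [set w | forall i, (i < n)%N -> A i w] = (\prod_(i < n) Q (A i))%E) ->
  mutually_independent Q F.
Proof.
move=> FT FQ J A FA.
pose A' i := if i \in J then A i else setT.
have FA' i : F i (A' i) by rewrite /A'; case: ifPn => // /FA.
pose n := (\max_(i <- J) i).+1.
have Jn i : i \in J -> (i < n)%N.
  by move=> iJ; rewrite ltnS (big_rem i)//= leq_maxl.
rewrite (_ : \bigcap_(i in _) _ = [set w | forall i, (i < n)%N -> A' i w]).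
  rewrite FQ// -(big_mkord xpredT (fun i => Q (A' i))).
  rewrite (eq_bigr (fun i => if i \in J then Q (A i) else 1%E)); last first.
    by move=> i _; rewrite /A'; case: ifP => // _; rewrite probability_setT.
  rewrite -big_mkcond -big_filter; apply: perm_big; apply: uniq_perm.
  - by rewrite filter_uniq// iota_uniq.
  - exact: fset_uniq.
  - move=> i; rewrite mem_filter mem_index_iota /=.
    by case iJ : (i \in J) => //=; rewrite Jn.
apply/seteqP; split => w /=.
  by move=> h i _; rewrite /A'; case: ifPn => // iJ; exact: h.
by move=> h i /= iJ; have := h i (Jn _ iJ); rewrite /A' iJ.
Qed.

Section marks.
Context (R : realType) (S : finType) (d : measure_display) (T : measurableType d).
Variables (Q : probability T R) (W : nat -> T -> S) (X : nat -> T -> R).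
Variable mu : S -> R.
Hypothesis mW : forall i z, measurable [set w | W i w = z].
Hypothesis mX : forall i, measurable_fun setT (X i).
Hypothesis X0 : forall i w, 0 <= X i w.
Hypothesis mu1 : \sum_z mu z = 1.
Hypothesis law : forall n (A : nat -> set S) (x : nat -> R),
  Pr Q [set w | forall i, (i < n)%N -> A i (W i w) /\ x i < X i w] =
  \prod_(i < n) ((\sum_(z | z \in A i) mu z) * exp_tail (x i)).

Let mWA i (A : set S) : measurable [set w | A (W i w)].
Proof. exact: (@measurable_fiber_set S _ T W mW). Qed.

Let muT : \sum_(z | z \in [set: S]) mu z = 1.
Proof. by rewrite -mu1; apply: eq_bigl => z; rewrite in_setT. Qed.

Lemma gaps_law n (x : nat -> R) :
  Pr Q [set w | forall i, (i < n)%N -> x i < X i w] = \prod_(i < n) exp_tail (x i).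
Proof.
have := law n (fun=> setT) x.
under eq_bigr do rewrite muT mul1r.
move=> <-; congr (Pr Q _); apply/seteqP; split => w /= h i ni; last by have [] := h i ni.
by split => //; exact: h.
Qed.

Lemma marks_law n (A : nat -> set S) :
  Pr Q [set w | forall i, (i < n)%N -> A i (W i w)] =
  \prod_(i < n) (\sum_(z | z \in A i) mu z).
Proof.
have := law n A (fun=> -1).
have -> : exp_tail (-1 : R) = 1 by rewrite /exp_tail max_r ?oppr0 ?expR0// lerN10.
under eq_bigr do rewrite mulr1.
move=> <-; congr (Pr Q _); apply/seteqP; split => w /= h i ni; last by have [] := h i ni.
by split; [exact: h|apply: lt_le_trans (X0 i w); exact: ltrN10].
Qed.

Lemma marks_law1 i (A : set S) : Pr Q [set w | A (W i w)] = \sum_(z | z \in A) mu z.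
Proof.
have := marks_law i.+1 (fun j => if j == i then A else setT).
rewrite big_ord_recr/= eqxx big1 ?mul1r => [<-|j _].
  congr (Pr Q _); apply/seteqP; split => w /=.
    by move=> Aw j _; case: eqP => [->|].
  by move=> /(_ i (ltnSn i)); rewrite eqxx.
by rewrite ltn_eqF// muT.
Qed.

Lemma marks_discrete i : discrete_RV (W i).
Proof. by move=> _ [A _ <-]; rewrite setTI; exact: mWA. Qed.

Lemma marks_finite_law i : has_finite_law Q (W i) mu.
Proof.
split; first exact: marks_discrete.
move=> z; rewrite PrE; last exact: mW.
congr EFin; rewrite (marks_law1 i [set z]) (big_pred1 z)// => y.
by apply/idP/eqP => [|->]; rewrite inE.
Qed.

Lemma marks_independent : mutually_independent Q (fun i => sigma_discrete (W i)).
Proof.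
apply: mutually_independent_initial.
  by move=> i; exists setT => //; rewrite setTI preimage_setT.
move=> n A FA.
have /choice [B HB] : forall i, exists B : set S, A i = [set w | B (W i w)].
  by move=> i; have [B _ <-] := FA i; exists B; rewrite setTI.
rewrite (_ : [set w | _] = [set w | forall i, (i < n)%N -> B i (W i w)]); last first.
  by apply/seteqP; split => w /= h i ni; have := h i ni; rewrite HB.
rewrite PrE; last first.
  by apply: (@measurable_forall_lt _ _ (fun i => [set w | B i (W i w)])).
rewrite marks_law -prodEFin; apply: eq_bigr => i _.
by rewrite HB PrE// marks_law1.
Qed.

Variable lam : R.
Hypothesis lam0 : 0 < lam.
Local Notation N := (arrival_count X lam).

Let mN : measurable_fun setT N.
Proof. exact: measurable_arrival_count. Qed.

Let mNk k : measurable [set w | N w = k].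
Proof. exact: measurable_nat_fiber1. Qed.

(** The count is a function of the gaps, which are independent of the marks.
    The rectangles of length [maxn n k.+1] see both the [n] marks and the
    [k.+1] gaps that are involved. *)
Lemma count_indep_cylinder k n (A : nat -> set S) :
  Pr Q ([set w | N w = k] `&` [set w | forall i, (i < n)%N -> A i (W i w)]) =
  Pr Q [set w | N w = k] * Pr Q [set w | forall i, (i < n)%N -> A i (W i w)].
Proof.
set H := [set w | forall i, _].
have mH : measurable H.
  by apply: (@measurable_forall_lt _ _ (fun i => [set w | A i (W i w)])).
have mP := measurable_passes mX lam.
have P1 := Pr_passes mX X0 gaps_law lam0.
rewrite -(PrI_full (mNk k) mP P1) -(PrI_full (measurableI _ _ (mNk k) mH) mP P1).
rewrite setIAC arrival_count_eq// setIC mulrC.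
(* Enough terms to see all the marks in H and the gaps that decide about k. *)
pose m := maxn n k.+1.
pose C := (~` [set f : nat -> R | \sum_(i < k.+1) f i <= lam]) `&`
          [set f : nat -> R | \sum_(i < k) f i <= lam].
have sC : <<s @rect R m >> C.
  apply: (@measurableI _ (g_sigma_algebraType (@rect R m))).
    by apply: measurableC; apply: seq_sigma_sum_le; rewrite leq_maxr.
  by apply: seq_sigma_sum_le; rewrite (leq_trans _ (leq_maxr _ _)).
rewrite (_ : _ `\` _ = [set w | C (X ^~ w)]); last first.
  apply/seteqP; split => w /=; rewrite /C /= /arrival.
    by move=> [h /negP]; rewrite -leNgt => h'; split => //; apply/negP; rewrite -ltNge.
  by move=> [/negP]; rewrite -ltNge => h h'; split => //; apply/negP; rewrite -leNgt.
apply: (@seq_product_rule R _ _ Q _ _ Q X X H m mX mX mH) => // x.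
pose A' i := if (i < n)%N then A i else setT.
have HE : H = [set w | forall i, (i < m)%N -> A' i (W i w)].
  apply/seteqP; split => w /=.
    by move=> h i _; rewrite /A'; case: ifP => // /h.
  move=> h i ni; have := h i (leq_trans ni (leq_maxl _ _)).
  by rewrite /A' ni.
rewrite HE marks_law gaps_law -big_split/= -law; congr (Pr Q _).
apply/seteqP; split => w /=; first by move=> [h1 h2] i im; split; [exact: h1|exact: h2].
by move=> h; split => i im; have [] := h i im.
Qed.

Lemma count_indep_marks k B : sigma_join (fun i => sigma_discrete (W i)) B ->
  Pr Q ([set w | N w = k] `&` B) = Pr Q [set w | N w = k] * Pr Q B.
Proof.
pose G : set (set T) := [set B | exists n (A : nat -> set S),
  B = [set w | forall i, (i < n)%N -> A i (W i w)]].
have mG C : G C -> measurable C.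
  move=> [n [A ->]].
  by apply: (@measurable_forall_lt _ _ (fun i => [set w | A i (W i w)])).
move=> HB.
have sB : <<s G >> B.
  move: HB; apply: smallest_sub; first exact: smallest_sigma_algebra.
  move=> C [i _ [A _ <-]]; apply: sub_sigma_algebra.
  exists i.+1, (fun j => if j == i then A else setT).
  rewrite setTI; apply/seteqP; split => w /=.
    by move=> Aw j _; case: eqP => [->|].
  by move=> /(_ i (ltnSn i)); rewrite eqxx.
have := @product_rule_sigma R _ _ Q _ _ Q T id id G [set w | N w = k].
apply => //.
  move=> _ _ [n [A ->]] [n' [A' ->]]; exists (maxn n n').
  exists (fun i => (if (i < n)%N then A i else setT) `&` (if (i < n')%N then A' i else setT)).
  apply/seteqP; split => w /=.
    move=> [h h'] i _; split; first by case: ifP => // /h.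
    by case: ifP => // /h'.
  move=> h; split => i ni.
    by have [+ _] := h i (leq_trans ni (leq_maxl _ _)); rewrite ni.
  by have [_ +] := h i (leq_trans ni (leq_maxr _ _)); rewrite ni.
by move=> _ [n [A ->]]; exact: count_indep_cylinder.
Qed.

Lemma sub_sigma_join_measurable : sigma_join (fun i => sigma_discrete (W i)) `<=` measurable.
Proof.
apply: smallest_sub; first exact: sigma_algebra_measurable.
by move=> C [i _ HC]; exact: marks_discrete HC.
Qed.

(** Events of the count are generated by its values and events of the marks by
    cylinders; the product rule is extended first to all the events of the
    marks, then to all those of the count. *)
Lemma count_independent (A : set nat) B : sigma_join (fun i => sigma_discrete (W i)) B ->
  Q ([set w | A (N w)] `&` B) = (Q [set w | A (N w)] * Q B)%E.
Proof.
move=> HB; have mB := sub_sigma_join_measurable HB.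
have mNA A' : measurable [set w | A' (N w)] by exact: (measurable_preimageT mN).
rewrite !PrE//; last exact: measurableI.
rewrite -EFinM; congr EFin; rewrite setIC mulrC.
pose G : set (set nat) := [set C | C = set0 \/ exists k, C = [set k]].
apply: (@product_rule_sigma R _ _ Q _ _ Q nat N N G B) => //.
- move=> C C' [->|[k ->]]; first by rewrite set0I; left.
  move=> [->|[k' ->]]; first by rewrite setI0; left.
  have [->|kk'] := eqVneq k k'; first by rewrite setIid; right; exists k'.
  by left; rewrite -subset0 => i /= [-> /eqP]; rewrite (negbTE kk').
- by move=> C _; exact: mNA.
- by move=> C _; exact: mNA.
- move=> _ [->|[k ->]]; first by rewrite preimage_set0 setI0 Pr_set0 mulr0.
  by rewrite setIC mulrC; exact: count_indep_marks.
- have [S0 _ SU] := smallest_sigma_algebra setT G.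
  rewrite (_ : A = \bigcup_k (if k \in A then [set k] else set0)).
    apply: SU => k; case: ifP => _; last exact: S0.
    by apply: sub_sigma_algebra; right; exists k.
  apply/seteqP; split => k /=.
    by move=> Ak; exists k => //; rewrite mem_set.
  by move=> [j _]; case: ifPn => // /set_mem Aj ->.
Qed.

End marks.

(** * The coupling *)

Definition RV_of (R : realType) d d' (T : measurableType d) (T' : measurableType d')
  (Q : probability T R) (f : T -> T') (mf : measurable_fun setT f) : {RV Q >-> T'} :=
  mfun_Sub (mem_set mf).

Section product.
Context (R : realType) d1 d2 (T1 : measurableType d1) (T2 : measurableType d2).
Variables (P1 : probability T1 R) (P2 : probability T2 R).
Definition prodP : probability (T1 * T2)%type R := (P1 \x P2)%E.

Lemma prodPE A B : measurable A -> measurable B ->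
  prodP [set w | A w.1 /\ B w.2] = (P1 A * P2 B)%E.
Proof.
by move=> mA mB; rewrite -[RHS]product_measure1E//; congr (prodP _); apply/seteqP; split.
Qed.

Lemma Pr_prodP A B : measurable A -> measurable B ->
  Pr prodP [set w | A w.1 /\ B w.2] = Pr P1 A * Pr P2 B.
Proof. by move=> mA mB; rewrite /Pr prodPE// fineM// fin_num_measure. Qed.

Lemma prodP_fst A : measurable A -> prodP [set w | A w.1] = P1 A.
Proof.
move=> mA; rewrite -[RHS]mule1 -(probability_setT P2) -prodPE//.
by congr (prodP _); apply/seteqP; split => w //= [].
Qed.

Lemma prodP_snd B : measurable B -> prodP [set w | B w.2] = P2 B.
Proof.
move=> mB; rewrite -[RHS]mul1e -(probability_setT P1) -prodPE//.
by congr (prodP _); apply/seteqP; split => w //= [].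
Qed.
End product.

Section exp_family.
Context (R : realType) (S : finType).
Local Notation P := (unif R).
Local Notation T0 := (measurableTypeR R).

Lemma measurable_gt_ray (b : R) : measurable [set x : R | b < x].
Proof.
rewrite (_ : [set x | _] = `]b, +oo[%classic); first exact: measurable_itv.
by apply/seteqP; split => x /=; rewrite in_itv/= andbT.
Qed.

Lemma expseq_gt n (b : nat -> R) : (forall i, 0 <= b i) ->
  Pr P [set u : T0 | forall i, (i < n)%N -> b i < expseq i u] =
  expR (- \sum_(i < n) b i).
Proof.
move=> b0.
have -> := @expseq_iid R n (fun i => [set x : R | b i < x]).
  by rewrite -sumrN expR_sum; apply: eq_bigr => i _; rewrite expo_of_tail.
by move=> i; exact: measurable_gt_ray.
Qed.

Lemma expseq_tail n (x : nat -> R) :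
  Pr P [set u : T0 | forall i, (i < n)%N -> x i < expseq i u] =
  \prod_(i < n) exp_tail (x i).
Proof.
have -> : [set u : T0 | forall i, (i < n)%N -> x i < expseq i u] =
    [set u : T0 | forall i, (i < n)%N -> Num.max (x i) 0 < expseq i u].
  apply/seteqP; split => u /= h i ni; have := h i ni; rewrite gt_max.
    by move=> ->; exact: expo_of_gt0.
  by case/andP.
rewrite expseq_gt; last by move=> i; rewrite le_max lexx orbT.
by rewrite -sumrN expR_sum.
Qed.

(** The terms of the sequence are allotted to the states by their rank. *)
Lemma expseq_gt_fin (a : S -> R) : (forall y, 0 <= a y) ->
  Pr P [set u : T0 | forall y, a y < expseq (enum_rank y) u] = expR (- \sum_y a y).
Proof.
move=> a0.
pose b i := oapp a 0 (nth None [seq Some y | y <- enum S] i).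
have b0 i : 0 <= b i by rewrite /b; case: nth => //= y; exact: a0.
have bE y : b (enum_rank y) = a y.
  rewrite /b (nth_map y) -?cardE ?ltn_ord//= -[in RHS](enum_rankK y).
  by rewrite /enum_val; congr a; apply: set_nth_default; rewrite -cardE ltn_ord.
have := @expseq_gt #|S| b b0.
have -> : \sum_(i < #|S|) b i = \sum_y a y.
  rewrite (reindex (@enum_rank S))/=; last by apply: onW_bij; exact: enum_rank_bij.
  by apply: eq_bigr => y _; rewrite bE.
move=> <-; congr (Pr P _); apply/seteqP; split => u /= h.
  move=> i iS; have := h (enum_val (Ordinal iS)).
  by rewrite -bE enum_valK.
by move=> y; rewrite -bE; apply: h; exact: ltn_ord.
Qed.

End exp_family.

Section transitions.
Variables (R : realType) (S : finType) (pi0 : S -> R) (p : S -> S -> R).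

Lemma trans_local (s s' : nat -> S) i :
  (forall j, (j <= i)%N -> s j = s' j) -> trans pi0 p s i = trans pi0 p s' i.
Proof.
move=> h; rewrite /trans h//; congr (rate pi0 p _ _).
by apply: eq_previous => j /ltnW; exact: h.
Qed.

Hypotheses (hp : stochastic p) (hpi0 : prob_vector pi0).

Lemma trans_sum (s : nat -> S) i : \sum_z trans pi0 p (update s i z) i = 1.
Proof.
have [_ <-] := rate_prob hp hpi0 (previous s i).
apply: eq_bigr => z _; rewrite /trans /update eqxx; congr (rate pi0 p _ _).
by apply: eq_previous => j ji; rewrite ltn_eqF.
Qed.

End transitions.

Section coupling.
Context (R : realType) (S : finType) (z0 : S).
Variables (pi0 pist : S -> R) (p : S -> S -> R).
Hypotheses (hp : stochastic p) (hpi0 : prob_vector pi0) (hpist : prob_vector pist).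
Local Notation P := (unif R).
Local Notation T0 := (measurableTypeR R).
Local Notation T1 := (T0 * (T0 * T0))%type.
(** Three independent sources: the initial clocks, shared by the two
    explorations, and one supply of refreshments for each of them. *)
Definition clock_prob : probability T1 R := prodP P (prodP P P).
(** A further source, independent of both explorations, for the variables xi of
    the theorem. The waiting times of the chain cannot play their role, as they
    are not independent of the number of marks. *)
Definition coupling_prob : probability (T1 * T0)%type R := prodP clock_prob P.
Local Notation Q1 := clock_prob.

Definition first_clock (y : S) (w : T1) : R := expseq (enum_rank y) w.1.
Definition refresh_Z (n : nat) (w : T1) : R := expseq n w.2.1.
Definition refresh_W (n : nat) (w : T1) : R := expseq n w.2.2.

Lemma measurable_first_clock y : measurable_fun setT (first_clock y).
Proof. exact: (measurableT_comp (@measurable_expseq R _) measurable_fst). Qed.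

Lemma measurable_refresh_Z n : measurable_fun setT (refresh_Z n).
Proof.
exact: (measurableT_comp (@measurable_expseq R _)
  (measurableT_comp measurable_fst measurable_snd)).
Qed.

Lemma measurable_refresh_W n : measurable_fun setT (refresh_W n).
Proof.
exact: (measurableT_comp (@measurable_expseq R _)
  (measurableT_comp measurable_snd measurable_snd)).
Qed.

Lemma first_clock_gt0 y w : 0 < first_clock y w.
Proof. exact: expo_of_gt0. Qed.

Lemma refresh_Z_gt0 n w : 0 < refresh_Z n w.
Proof. exact: expo_of_gt0. Qed.

Lemma refresh_W_gt0 n w : 0 < refresh_W n w.
Proof. exact: expo_of_gt0. Qed.

Let m_fin (a : S -> R) : measurable [set u : T0 | forall y, a y < expseq (enum_rank y) u].
Proof.
apply: (@measurable_forall_fin _ _ _ (fun y => [set u : T0 | a y < expseq (enum_rank y) u])).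
move=> y; apply: measurable_lt_set; first exact: measurable_cst.
exact: measurable_expseq.
Qed.

Let m_seq k (b : nat -> R) :
  measurable [set u : T0 | forall i, (i < k)%N -> b i < expseq i u].
Proof.
apply: (@measurable_forall_lt _ _ (fun i => [set u : T0 | b i < expseq i u])).
move=> i _; apply: measurable_lt_set; first exact: measurable_cst.
exact: measurable_expseq.
Qed.

Let m_pre1 k (b : nat -> R) : measurable [set w : T0 * T0 |
  [set u : T0 | forall i, (i < k)%N -> b i < expseq i u] w.1].
Proof.
have := measurable_preimageT (@measurable_fst _ _ T0 T0) (m_seq k b).
by [].
Qed.

Let m_pre2 k (b : nat -> R) : measurable [set w : T0 * T0 |
  [set u : T0 | forall i, (i < k)%N -> b i < expseq i u] w.2].
Proof.
have := measurable_preimageT (@measurable_snd _ _ T0 T0) (m_seq k b).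
by [].
Qed.

Lemma refresh_Z_law k (a : S -> R) (b : nat -> R) :
  (forall y, 0 <= a y) -> (forall i, 0 <= b i) ->
  Pr Q1 [set w | (forall y, a y < first_clock y w) /\
                (forall i, (i < k)%N -> b i < refresh_Z i w)] =
  expR (- \sum_y a y) * expR (- \sum_(i < k) b i).
Proof.
move=> a0 b0; rewrite -(expseq_gt_fin a0) -(expseq_gt k b0).
rewrite [X in _ = _ * X](_ : _ = Pr (prodP P P)
  [set w | [set u : T0 | forall i, (i < k)%N -> b i < expseq i u] w.1]).
  by rewrite -Pr_prodP.
by rewrite /Pr prodP_fst.
Qed.

Lemma refresh_W_law k (a : S -> R) (b : nat -> R) :
  (forall y, 0 <= a y) -> (forall i, 0 <= b i) ->
  Pr Q1 [set w | (forall y, a y < first_clock y w) /\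
                (forall i, (i < k)%N -> b i < refresh_W i w)] =
  expR (- \sum_y a y) * expR (- \sum_(i < k) b i).
Proof.
move=> a0 b0; rewrite -(expseq_gt_fin a0) -(expseq_gt k b0).
rewrite [X in _ = _ * X](_ : _ = Pr (prodP P P)
  [set w | [set u : T0 | forall i, (i < k)%N -> b i < expseq i u] w.2]).
  by rewrite -Pr_prodP.
by rewrite /Pr prodP_snd.
Qed.

Local Notation Z := (state z0 pi0 p first_clock refresh_Z).
Local Notation XZ := (waiting z0 pi0 p first_clock refresh_Z).
Local Notation W := (state z0 pist (fun=> pist) first_clock refresh_W).
Local Notation XW := (waiting z0 pist (fun=> pist) first_clock refresh_W).

Local Notation mE := measurable_first_clock.
Local Notation mFZ := measurable_refresh_Z.
Local Notation mFW := measurable_refresh_W.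

Let hq : stochastic (fun _ : S => pist).
Proof. by []. Qed.

Lemma Z_law n (s : nat -> S) (x : nat -> R) :
  Pr Q1 [set w | forall i, (i < n)%N -> Z i w = s i /\ x i < XZ i w] =
  \prod_(i < n) (trans pi0 p s i * exp_tail (x i)).
Proof.
have Ha i s' : (n <= i)%N ->
    \sum_(z | z \in [set: S]) trans pi0 p (update s' i z) i = 1.
  by move=> _; rewrite -(trans_sum hp hpi0 s' i); apply: eq_bigl => z; rewrite in_setT.
have := @path_marginal_tail R S _ _ Q1 Z XZ (trans pi0 p)
  (measurable_state z0 pi0 p mE mFZ) (measurable_waiting z0 pi0 p mE mFZ)
  (@trans_local R S pi0 p) (trans_sum hp hpi0)
  (path_law z0 hp hpi0 mE mFZ first_clock_gt0 refresh_Z_gt0 refresh_Z_law)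
  z0 n n s (fun=> setT) (fun=> 1) x (leqnn n) Ha.
under [X in _ = X -> _]eq_bigr => i _ do rewrite ltn_ord.
move=> <-; congr (Pr Q1 _); apply/seteqP; split => w /= h i ni.
  by rewrite ni; exact: h.
by have := h i ni; rewrite ni.
Qed.

Lemma W_law n (A : nat -> set S) (x : nat -> R) :
  Pr Q1 [set w | forall i, (i < n)%N -> A i (W i w) /\ x i < XW i w] =
  \prod_(i < n) ((\sum_(z | z \in A i) pist z) * exp_tail (x i)).
Proof.
have := @path_marginal_tail R S _ _ Q1 W XW (trans pist (fun=> pist))
  (measurable_state z0 pist _ mE mFW) (measurable_waiting z0 pist _ mE mFW)
  (@trans_local R S pist _) (trans_sum hq hpist)
  (path_law z0 hq hpist mE mFW first_clock_gt0 refresh_W_gt0 refresh_W_law)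
  z0 n 0 (fun=> z0) A (fun i => \sum_(z | z \in A i) pist z) x (leq0n n).
move=> <- //.
move=> i s _; apply: eq_bigr => z _.
by rewrite /trans rate_iid /update eqxx.
Qed.

End coupling.

Section transfer.
Context (R : realType) (S : finType) (z0 : S).
Variables (pi0 pist : S -> R) (p : S -> S -> R).
Hypotheses (hp : stochastic p) (hpi0 : prob_vector pi0) (hpist : prob_vector pist).
Local Notation P := (unif R).
Local Notation T0 := (measurableTypeR R).
Local Notation T1 := (T0 * (T0 * T0))%type.
Local Notation Q1 := (clock_prob R).
Local Notation Q := (coupling_prob R).
Local Notation E := (@first_clock R S).
Local Notation FZ := (@refresh_Z R).
Local Notation FW := (@refresh_W R).
Local Notation mE := (@measurable_first_clock R S).
Local Notation mFZ := (@measurable_refresh_Z R).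
Local Notation mFW := (@measurable_refresh_W R).
Local Notation Z := (state z0 pi0 p E FZ).
Local Notation XZ := (waiting z0 pi0 p E FZ).
Local Notation W := (state z0 pist (fun=> pist) E FW).
Local Notation XW := (waiting z0 pist (fun=> pist) E FW).

Let mZ i z : measurable [set w | Z i w = z].
Proof. exact: measurable_state mE mFZ i z. Qed.
Let mXZ i : measurable_fun setT (XZ i).
Proof. exact: measurable_waiting mE mFZ i. Qed.
Let mW i z : measurable [set w | W i w = z].
Proof. exact: measurable_state mE mFW i z. Qed.
Let mXW i : measurable_fun setT (XW i).
Proof. exact: measurable_waiting mE mFW i. Qed.

Lemma Pr_fst A : measurable A -> Pr Q [set w | A w.1] = Pr Q1 A.
Proof. by move=> mA; rewrite /Pr prodP_fst. Qed.

Lemma Pr_rect A B : measurable A -> measurable B ->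
  Pr Q [set w | A w.1 /\ B w.2] = Pr Q1 A * Pr P B.
Proof. exact: Pr_prodP. Qed.

Lemma measurable_fst_set d1 d2 (U1 : measurableType d1) (U2 : measurableType d2)
  (A : set U1) : measurable A -> measurable [set w : U1 * U2 | A w.1].
Proof. by move=> mA; have := measurable_preimageT (@measurable_fst _ _ U1 U2) mA. Qed.

Lemma measurable_snd_set d1 d2 (U1 : measurableType d1) (U2 : measurableType d2)
  (A : set U2) : measurable A -> measurable [set w : U1 * U2 | A w.2].
Proof. by move=> mA; have := measurable_preimageT (@measurable_snd _ _ U1 U2) mA. Qed.

Lemma measurable_seq_event d (T : measurableType d) (X : nat -> T -> R) n A :
  (forall i, measurable_fun setT (X i)) -> <<s @rect R n >> A ->
  measurable [set w | A (X ^~ w)].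
Proof.
move=> mX; apply: (@preimage_sigma _ T (nat -> R) (fun w => X ^~ w) (@rect R n)).
move=> _ [x ->]; apply: (@measurable_forall_lt _ _ (fun i => [set w | x i < X i w])).
by move=> i _; apply: measurable_lt_set => //; exact: measurable_cst.
Qed.

(** An event on the chain and its waiting times has the same probability when
    the waiting times are replaced with an independent sequence of
    exponentials. Once the finitely many relevant states of the chain are
    fixed, both probabilities are products. *)
Lemma same_law t (A : (nat -> S) -> set (nat -> R)) :
  (forall s, <<s @rect R t.+1 >> (A s)) ->
  (forall s s', (forall i, (i < t.+1)%N -> s i = s' i) -> A s = A s') ->
  [/\ measurable [set w : T1 * T0 | A (Z ^~ w.1) (expseq (R := R) ^~ w.2)],
      measurable [set w | A (Z ^~ w) (XZ ^~ w)] &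
  Pr Q [set w | A (Z ^~ w.1) (expseq (R := R) ^~ w.2)] =
  Pr Q1 [set w | A (Z ^~ w) (XZ ^~ w)]].
Proof.
move=> sA Aloc.
pose D (w : T1) : {ffun 'I_t.+1 -> S} := [ffun i : 'I_t.+1 => Z i w].
pose ext (phi : {ffun 'I_t.+1 -> S}) (i : nat) : S := phi (inord i).
have extD w i : (i < t.+1)%N -> Z i w = ext (D w) i.
  by move=> it; rewrite /ext ffunE inordK.
have AD w : A (Z ^~ w) = A (ext (D w)) by apply: Aloc => i; exact: extD.
have DE phi : [set w | D w = phi] =
    [set w | forall i, (i < t.+1)%N -> Z i w = ext phi i].
  apply/seteqP; split => w /=; first by move=> <- i; exact: extD.
  by move=> h; apply/ffunP => i; rewrite ffunE h// /ext inord_val.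
have mD phi : measurable [set w | D w = phi].
  rewrite DE; apply: (@measurable_forall_lt _ _ (fun i => [set w | Z i w = ext phi i])).
  by move=> i _; exact: mZ.
have mAZ phi : measurable [set w | A (ext phi) (XZ ^~ w)].
  exact: measurable_seq_event mXZ (sA _).
have mAe phi : measurable [set u : T0 | A (ext phi) (expseq (R := R) ^~ u)].
  exact: measurable_seq_event (@measurable_expseq R) (sA _).
have mLs : measurable [set w | A (Z ^~ w) (XZ ^~ w)].
  rewrite [X in measurable X](_ : _ = [set w | exists phi,
     ([set w | D w = phi] `&` [set w | A (ext phi) (XZ ^~ w)]) w]).
    by apply: measurable_exists_count => phi; exact: measurableI.
  apply/seteqP; split => w /=; first by rewrite AD; exists (D w).
  by move=> [phi [<-]]; rewrite -AD.
have mDf phi : measurable [set w : T1 * T0 | D w.1 = phi].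
  exact: measurable_fst_set (mD phi).
have mL : measurable [set w : T1 * T0 | A (Z ^~ w.1) (expseq (R := R) ^~ w.2)].
  rewrite [X in measurable X](_ : _ = [set w : T1 * T0 | exists phi,
     ([set w | D w.1 = phi] `&`
      [set w | A (ext phi) (expseq (R := R) ^~ w.2)]) w]).
    apply: measurable_exists_count => phi; apply: measurableI => //.
    exact: measurable_snd_set (mAe phi).
  apply/seteqP; split => w /=; first by rewrite AD; exists (D w.1).
  by move=> [phi [<-]]; rewrite -AD.
split => //.
have f1 := @Pr_fiber _ _ _ Q _ (fun w => D w.1) _ setT mL mDf.
have f2 := @Pr_fiber _ _ _ Q1 _ D _ setT mLs mD.
rewrite [X in _ `&` X](_ : _ = setT) ?setIT in f1; last by apply/seteqP; split.
rewrite [X in _ `&` X](_ : _ = setT) ?setIT in f2; last by apply/seteqP; split.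
rewrite f1 f2; apply: eq_bigr => phi _.
transitivity (Pr Q1 [set w | D w = phi] *
   Pr P [set u : T0 | A (ext phi) (expseq (R := R) ^~ u)]).
  have <- := Pr_rect (mD phi) (mAe phi).
  congr (Pr Q _); apply/seteqP; split => w /=.
    by move=> [+ <-]; rewrite AD.
  by move=> [<-]; rewrite AD.
rewrite (_ : _ `&` _ = [set w | D w = phi] `&` [set w | A (ext phi) (XZ ^~ w)]); last first.
  apply/seteqP; split => w /=; first by move=> [+ <-]; rewrite AD.
  by move=> [<-]; rewrite AD.
apply/esym; apply: (@seq_product_rule R _ _ Q1 _ _ P XZ (@expseq R) _ t.+1) => //.
  exact: measurable_expseq.
move=> x; rewrite expseq_tail.
have one : exp_tail (-1 : R) = 1 by rewrite /exp_tail max_r ?oppr0 ?expR0// lerN10.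
have XZ0 i w : 0 <= XZ i w.
  by apply: waiting_ge0; [exact: first_clock_gt0|exact: refresh_Z_gt0].
have -> : Pr Q1 [set w | D w = phi] = \prod_(i < t.+1) trans pi0 p (ext phi) i.
  have := @Z_law R S z0 pi0 p hp hpi0 t.+1 (ext phi) (fun=> -1).
  under eq_bigr do rewrite one mulr1.
  move=> <-; congr (Pr Q1 _); rewrite DE; apply/seteqP; split => w /= h i it.
    by split; [exact: h|apply: lt_le_trans (XZ0 i w); exact: ltrN10].
  by have [] := h i it.
rewrite -big_split/= -(Z_law z0 hp hpi0) DE; congr (Pr Q1 _).
apply/seteqP; split => w /=.
  by move=> [h1 h2] i it; split; [exact: h1|exact: h2].
by move=> h; split => i it; have [] := h i it.
Qed.

Lemma chain_waiting_pos n : Pr Q1 [set w | forall i, (i < n)%N -> 0 < XZ i w] = 1.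
Proof.
exact: (@waiting_pos R S _ _ Q1 Z XZ (trans pi0 p) mZ mXZ
  (@trans_local R S pi0 p) (trans_sum hp hpi0)
  (path_law z0 hp hpi0 mE mFZ (@first_clock_gt0 R S) (@refresh_Z_gt0 R)
     (@refresh_Z_law R S)) z0 n).
Qed.

Definition chain (i : nat) (w : T1 * T0) : S := Z i w.1.
Definition mark (i : nat) (w : T1 * T0) : S := W i w.1.
Definition gap (i : nat) (w : T1 * T0) : R := XW i w.1.
Definition fresh (i : nat) (w : T1 * T0) : R := expseq i w.2.
Definition mark_count (lam : R) (w : T1 * T0) : nat := arrival_count gap lam w.

Lemma measurable_mark i z : measurable [set w | mark i w = z].
Proof. exact: measurable_fst_set (mW i z). Qed.

Lemma measurable_chain i z : measurable [set w | chain i w = z].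
Proof. exact: measurable_fst_set (mZ i z). Qed.

Lemma measurable_gap i : measurable_fun setT (gap i).
Proof. exact: (measurableT_comp (mXW i) measurable_fst). Qed.

Lemma gap_ge0 i w : 0 <= gap i w.
Proof. by apply: waiting_ge0; [exact: first_clock_gt0|exact: refresh_W_gt0]. Qed.

Lemma measurable_fresh i : measurable_fun setT (fresh i).
Proof. exact: (measurableT_comp (@measurable_expseq R i) measurable_snd). Qed.

Lemma mark_law n (A : nat -> set S) (x : nat -> R) :
  Pr Q [set w | forall i, (i < n)%N -> A i (mark i w) /\ x i < gap i w] =
  \prod_(i < n) ((\sum_(z | z \in A i) pist z) * exp_tail (x i)).
Proof.
rewrite -(W_law z0 hpist) -Pr_fst//.
apply: (@measurable_forall_lt _ _ (fun i => [set w | A i (W i w)] `&` [set w | x i < XW i w])).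
move=> i _; apply: measurableI; first exact: (@measurable_fiber_set S _ T1 W mW).
by apply: measurable_lt_set => //; exact: measurable_cst.
Qed.

Lemma chain_path n (s : nat -> S) :
  Q [set w | forall i, (i < n)%N -> chain i w = s i] =
  (\prod_(i < n) trans pi0 p s i)%:E.
Proof.
have mH : measurable [set w | forall i, (i < n)%N -> Z i w = s i].
  apply: (@measurable_forall_lt _ _ (fun i => [set w | Z i w = s i])).
  by move=> i _; exact: mZ.
rewrite PrE; last exact: measurable_fst_set mH.
congr EFin; rewrite (Pr_fst mH).
have := @Z_law R S z0 pi0 p hp hpi0 n s (fun=> -1).
have one : exp_tail (-1 : R) = 1 by rewrite /exp_tail max_r ?oppr0 ?expR0// lerN10.
under eq_bigr do rewrite one mulr1.
move=> <-; congr (Pr Q1 _); apply/seteqP; split => w /= h i it.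
  split; first exact: h.
  apply: (@lt_le_trans _ _ 0); first exact: ltrN10.
  by apply: waiting_ge0; [exact: first_clock_gt0|exact: refresh_Z_gt0].
by have [] := h i it.
Qed.

Lemma chain_markov : markov_chain Q pi0 p chain.
Proof.
have dc i : discrete_RV (chain i).
  move=> _ [A _ <-]; rewrite setTI.
  exact: (@measurable_fiber_set S _ _ chain measurable_chain).
split => //.
  split => // z.
  have := chain_path 1 (fun=> z); rewrite big_ord_recr big_ord0 /= mul1r => <-.
  congr (Q _); apply/seteqP; split => w /=; first by move=> cz [].
  exact.
move=> n s.
have E m : [set w | forall i, (i <= m)%N -> chain i w = s i] =
    [set w | forall i, (i < m.+1)%N -> chain i w = s i].
  by apply/seteqP; split.
by rewrite !E !chain_path -EFinM big_ord_recr.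
Qed.

Lemma expseq_marginal i A : measurable A ->
  P [set u : T0 | A (expseq i u)] = exponential_prob 1 A.
Proof.
move=> mA.
have m1 : measurable [set u : T0 | A (expseq i u)].
  exact: (measurable_preimageT (@measurable_expseq R i) mA).
have m2 : measurable [set u : T0 | A (expo_of (u : R))].
  exact: (measurable_preimageT (@measurable_expo_of R) mA).
rewrite -expo_of_law// !PrE//; congr EFin.
pose B j := if j == i then A else setT.
have mB j : measurable (B j) by rewrite /B; case: eqP.
have := @expseq_iid R i.+1 B mB.
rewrite big_ord_recr/= /B eqxx big1 ?mul1r => [<-|j _].
  congr (Pr P _); apply/seteqP; split => u /=.
    by move=> Au j _; case: eqP => [->|].
  by move=> /(_ i (ltnSn i)); rewrite eqxx.
by rewrite ltn_eqF//= Pr_setT.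
Qed.

Lemma fresh_marginal i A : measurable A ->
  Q [set w | A (fresh i w)] = exponential_prob 1 A.
Proof.
move=> mA; rewrite -(expseq_marginal i mA).
apply: (@prodP_snd _ _ _ T1 T0 Q1 P).
exact: (measurable_preimageT (@measurable_expseq R i) mA).
Qed.

Lemma fresh_independent :
  mutually_independent Q (fun i => preimage_set_system setT (fresh i) measurable).
Proof.
apply: mutually_independent_initial.
  by move=> i; exists setT => //; rewrite setTI preimage_setT.
move=> n A FA.
have /choice [B HB] : forall i, exists B : set R, measurable B /\ A i = [set w | B (fresh i w)].
  by move=> i; have [B mB <-] := FA i; exists B; rewrite setTI.
have mB i : measurable (B i) by have [] := HB i.
have AE i : A i = [set w | B i (fresh i w)] by have [] := HB i.
have mS i : measurable [set u : T0 | B i (expseq i u)].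
  exact: (measurable_preimageT (@measurable_expseq R i) (mB i)).
have mSn : measurable [set u : T0 | forall i, (i < n)%N -> B i (expseq i u)].
  exact: (@measurable_forall_lt _ _ (fun i => [set u : T0 | B i (expseq i u)])).
rewrite (_ : [set w | _] = [set w | [set u : T0 | forall i, (i < n)%N -> B i (expseq i u)] w.2]); last first.
  by apply/seteqP; split => w /= h i ni; have := h i ni; rewrite AE.
rewrite (prodP_snd Q1 P mSn) PrE// expseq_iid// -prodEFin; apply: eq_bigr => i _.
rewrite AE fresh_marginal// -expo_of_law// PrE//.
exact: (measurable_preimageT (@measurable_expo_of R) (mB i)).
Qed.

Lemma split_independent (F G : set (set (T1 * T0))) :
  (forall A, F A -> exists2 B : set T1, measurable B & A = [set w | B w.1]) ->
  (forall A, G A -> exists2 B : set T0, measurable B & A = [set w | B w.2]) ->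
  independent2 Q <<s G >> <<s F >>.
Proof.
move=> HF HG A B GA FB.
have [A' mA' ->] : exists2 A' : set T0, measurable A' & A = [set w | A' w.2].
  have : preimage_set_system setT (@snd T1 T0) measurable A.
    move: GA; apply: smallest_sub.
      exact/sigma_algebra_preimage/sigma_algebra_measurable.
    by move=> C /HG[D mD ->]; exists D => //; rewrite setTI.
  by move=> [D mD <-]; exists D => //; rewrite setTI.
have [B' mB' ->] : exists2 B' : set T1, measurable B' & B = [set w | B' w.1].
  have : preimage_set_system setT (@fst T1 T0) measurable B.
    move: FB; apply: smallest_sub.
      exact/sigma_algebra_preimage/sigma_algebra_measurable.
    by move=> C /HF[D mD ->]; exists D => //; rewrite setTI.
  by move=> [D mD <-]; exists D => //; rewrite setTI.
rewrite (prodP_snd Q1 P mA') (prodP_fst Q1 P mB') muleC -(prodPE Q1 P mB' mA').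
by congr (Q _); apply/seteqP; split => w /= [].
Qed.

(** After [same_law] the event on the left is that the local time of the chain
    is at most [lam * pist] everywhere. On it the initial clock of each visited
    state is at most [lam * pist] at that state by [visited_le], and so the
    state is among the marks by [reached]. *)
Lemma coupling_ineq (lam : R) (t : nat) : 0 < lam ->
  (Q [set w | forall z : S, (fresh 0 w * pi0 z
       + \sum_(1 <= j < t) fresh j w * p (chain j.-1 w) z <= lam * pist z)%R] <=
   Q [set w | [set chain i w | i in `I_t] `<=`
              [set mark k w | k in `I_(mark_count lam w)]])%E.
Proof.
move=> lam0.
pose R1 n := [set w : T1 | [set Z i w | i in `I_n] `<=`
              [set W k w | k in `I_(arrival_count XW lam w)]].
have mN : measurable_fun setT (arrival_count XW lam) by exact: measurable_arrival_count.
have mR1 n : measurable (R1 n).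
  rewrite [X in measurable X](_ : _ = [set w | forall i, (i < n)%N ->
      [set w | exists k, ([set w | (k < arrival_count XW lam w)%N] `&`
         [set w | exists z, ([set w | W k w = z] `&` [set w | Z i w = z]) w]) w] w]).
    apply: measurable_forall_lt => i _; apply: measurable_exists_count => k.
    apply: measurableI; first exact: (measurable_nat_fiber (fun m => k < m)%N mN).
    by apply: measurable_exists_count => z; exact: measurableI.
  apply/seteqP; split => w.
    move=> h i ni; have [k kN Wk] := h (Z i w) (ex_intro2 _ _ i ni erefl).
    by exists k; split => //; exists (Z i w).
  move=> h _ [i ni <-]; have [k [kN [z [Wk Zi]]]] := h i ni.
  by exists k => //; rewrite Wk Zi.
have QR : Q [set w | [set chain i w | i in `I_t] `<=`
              [set mark k w | k in `I_(mark_count lam w)]] = (Pr Q1 (R1 t))%:E.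
  by rewrite -(PrE Q1 (mR1 t)); exact: (prodP_fst Q1 P (mR1 t)).
(* For t = 0 there is nothing to visit, while the event on the left still
   involves the first term of the sum; the right-hand side is 1. *)
rewrite QR; case: t {QR} => [|t].
  rewrite (_ : R1 0 = setT) ?Pr_setT; last first.
    by apply/seteqP; split => w // _ y [i]; rewrite /= ltn0.
  apply: probability_le1.
  apply: (@measurable_forall_fin _ _ _ (fun z => [set w : T1 * T0 | _ <= lam * pist z])) => z.
  apply: measurable_le_set; last exact: measurable_cst.
  under eq_fun do rewrite big_geq// addr0.
  by apply: measurable_funM; [exact: measurable_fresh|exact: measurable_cst].
pose A (s : nat -> S) : set (nat -> R) := [set f | forall z, f 0 * pi0 z
   + \sum_(1 <= j < t.+1) f j * p (s j.-1) z <= lam * pist z].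
have sA s : <<s @rect R t.+1 >> (A s).
  suff : measurable (A s : set (g_sigma_algebraType (@rect R t.+1))) by [].
  apply: (@measurable_forall_fin _ (g_sigma_algebraType (@rect R t.+1)) _
    (fun z => [set f : nat -> R | _ <= lam * pist z])) => z.
  apply: (@measurable_le_set _ (g_sigma_algebraType (@rect R t.+1))); last exact: measurable_cst.
  rewrite [X in measurable_fun _ X](_ : _ = fun f : g_sigma_algebraType (@rect R t.+1) =>
     (f : nat -> R) 0 * pi0 z + \sum_(j < t) (f : nat -> R) j.+1 * p (s j) z); last first.
    by apply/funext => f; rewrite big_add1 /= big_mkord.
  apply: measurable_funD.
    by apply: measurable_funM; [exact: measurable_coord|exact: measurable_cst].
  apply: measurable_sum => j; apply: measurable_funM; last exact: measurable_cst.
  by apply: measurable_coord; rewrite ltnS.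
have Aloc s s' : (forall i, (i < t.+1)%N -> s i = s' i) -> A s = A s'.
  move=> ss'; rewrite /A; apply/seteqP; split => f /= h z; have := h z;
    rewrite !big_add1 /= !big_mkord; congr (_ + _ <= _); apply: eq_bigr => j _;
    by rewrite ss'// ltnW// ltnS.
have [mL mLs LE] := same_law sA Aloc.
rewrite (_ : [set w | _] = [set w : T1 * T0 | A (Z ^~ w.1) (expseq (R := R) ^~ w.2)])//.
rewrite (PrE Q mL) lee_fin LE.
have mpos : measurable [set w | forall i, (i < t.+1)%N -> 0 < XZ i w].
  apply: (@measurable_forall_lt _ _ (fun i => [set w | 0 < XZ i w])) => i _.
  by apply: measurable_lt_set => //; exact: measurable_cst.
have mpass := measurable_passes mXW lam.
have XW0 i w : 0 <= XW i w.
  by apply: waiting_ge0; [exact: first_clock_gt0|exact: refresh_W_gt0].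
have [_ mu1] := hpist.
have pass1 := Pr_passes mXW XW0 (gaps_law mu1 (W_law z0 hpist)) lam0.
rewrite -(PrI_full mLs mpos (chain_waiting_pos t.+1)).
rewrite -(PrI_full (measurableI _ _ mLs mpos) mpass pass1).
apply: le_Pr => //; first by apply: measurableI => //; exact: measurableI.
move=> w [[Lw pos] pass] _ [i it <-].
have : E (Z i w) w <= lam * pist (Z i w).
  apply: le_trans (Lw (Z i w)).
  rewrite -(local_time_markov z0 pi0 p E FZ).
  by apply: (visited_le hp hpi0 (@first_clock_gt0 R S) (@refresh_Z_gt0 R) it pos).
by move=> /(reached hpist (@first_clock_gt0 R S) (@refresh_W_gt0 R) lam0 pass)[k kN <-]; exists k.
Qed.

End transfer.

Theorem proposition1p2 (R : realType) (S : finType)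
    (p : S -> S -> R) (pi0 pist : S -> R)
    (hp : stochastic p) (hpi0 : prob_vector pi0) (hpist : stationary p pist) :
  exists (d : measure_display) (Omega : measurableType d)
         (Q : probability Omega R)
         (Z W : nat -> Omega -> S)
         (xi : nat -> {RV Q >-> R})
         (N : R -> {RV Q >-> nat}),
    [/\ markov_chain Q pi0 p Z,
        (forall i, has_finite_law Q (W i) pist) /\
          mutually_independent Q (fun i => sigma_discrete (W i)),
        (forall i, has_law (xi i) (exponential_prob 1)) /\
          mutually_independent Q (fun i => sigma_RV (xi i)),
        (* the last argument of [poisson_prob] is a dummy *)
        forall lambda : R, 0 < lambda ->
          [/\ has_law (N lambda) (poisson_prob lambda 0),
              independent2 Q (sigma_RV (N lambda))
                (sigma_join (fun i => sigma_discrete (W i))) &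
              independent2 Q (sigma_join (fun i => sigma_RV (xi i)))
                <<s sigma_join (fun i => sigma_discrete (Z i))
                    `|` sigma_RV (N lambda) >>] &
        forall (lambda : R) (t : nat), 0 < lambda ->
          (Q [set w | forall z : S,
                (xi 0%N w * pi0 z
                   + \sum_(1 <= j < t) xi j w * p (Z j.-1 w) z
                 <= lambda * pist z)%R]
           <=
           Q [set w | [set Z i w | i in `I_t]
                        `<=` [set W k w | k in `I_(N lambda w)]])%E].
Proof.
(* The default winner of a tie, from the nonempty support of pist. *)
have [z0 _] : exists z0 : S, True.
  apply: contrapT => noS; have [[_ /eqP]] := hpist.
  rewrite big1; first by rewrite eq_sym oner_eq0.
  by move=> z _; case: noS; exists z.
have [hmu _] := hpist; have [_ mu1] := hmu.
have mm := measurable_mark (S := S) (R := R) z0 pist.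
have mg := measurable_gap (S := S) (R := R) z0 pist.
have g0 := gap_ge0 (S := S) (R := R) z0 pist.
have mlaw := mark_law z0 hmu.
pose N lam : {RV coupling_prob R >-> nat} :=
  RV_of (coupling_prob R) (measurable_arrival_count mg lam).
pose xi i : {RV coupling_prob R >-> R} := RV_of (coupling_prob R) (measurable_fresh (R := R) i).
exists _, _, (coupling_prob R), (chain z0 pi0 p), (mark z0 pist), xi, N.
have gl := gaps_law mu1 mlaw.
split.
- exact: chain_markov.
- split; first by move=> i; exact: (marks_finite_law mm g0 mu1 mlaw).
  exact: (marks_independent mm g0 mu1 mlaw).
- split; first by move=> i A mA; exact: fresh_marginal.
  exact: fresh_independent.
- move=> lam lam0; split.
  + by move=> A _; exact: (arrival_count_law mg g0 gl lam0).
  + move=> _ B [A _ <-] HB; rewrite setTI.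
    exact: (count_independent mm mg g0 mu1 mlaw lam0).
  + apply: split_independent.
      move=> A [HA|[C _ <-]]; last first.
        rewrite setTI; exists [set w | C (arrival_count (waiting z0 pist (fun=> pist)
            (@first_clock R S) (@refresh_W R)) lam w)] => //.
        apply: measurable_preimageT => //; apply: measurable_arrival_count => i.
        exact: measurable_waiting (@measurable_first_clock R S) (@measurable_refresh_W R) i.
      have : preimage_set_system setT fst measurable A.
        move: HA; apply: smallest_sub.
          exact/sigma_algebra_preimage/sigma_algebra_measurable.
        move=> _ [i _ [C _ <-]].
        exists [set w | C (state z0 pi0 p (@first_clock R S) (@refresh_Z R) i w)].
          apply: (@measurable_fiber_set S _ _
            (state z0 pi0 p (@first_clock R S) (@refresh_Z R))) => j z.
          exact: measurable_state (@measurable_first_clock R S) (@measurable_refresh_Z R) j z.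
        by rewrite !setTI.
      by move=> [D mD <-]; exists D => //; rewrite setTI.
    move=> _ [i _ [C mC <-]]; rewrite setTI; exists [set u | C (expseq i u)] => //.
    exact: (measurable_preimageT (@measurable_expseq R i) mC).
- by move=> lam t lam0; exact: coupling_ineq.
Qed.
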